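(* Let $G$ be a finitely presented group which is LERF. Then either $G$ has virtual first Betti number equal to $0$ (i.e. $\beta_1(H)=0$ for every finite index subgroup $H$ of $G$), or $G$ is large, or $G$ is virtually $L\rtimes\mathbb{Z}$ for some finitely generated group $L$ (i.e. $G$ has a finite index subgroup isomorphic to a semidirect product $L\rtimes\mathbb{Z}$ with $L$ finitely generated).
   Context: A finitely generated group is large if it has a finite index subgroup possessing a homomorphism onto a non-abelian free group. A group is LERF (subgroup separable) if every finitely generated subgroup is an intersection of finite index subgroups. $\beta_1(H)$ denotes the first Betti number of $H$, i.e. the rank of the abelianisation $H/H'$. *)

(* Defs.v *)
From HB Require Import structures.
From mathcomp Require Import all_boot ssralg ssrint generic_quotient.
From mathcomp Require Import boolp classical_sets cardinality.

Set Implicit Arguments.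
Unset Strict Implicit.
Unset Printing Implicit Defensive.

Local Open Scope classical_set_scope.
Local Open Scope quotient_scope.
Local Open Scope group_scope.

Definition is_subgroup (G : groupType) (A : set G) : Prop :=
  group_closed (fun x => x \in A).

Lemma is_subgroupP (G : groupType) (A : set G) :
  is_subgroup A <-> A 1 /\ forall x y, A x -> A y -> A (x / y).
Proof.
split=> [[A1 AF] | [A1 AF]]; split.
- exact: set_mem.
- by move=> x y Ax Ay; apply: set_mem; apply: AF; apply: mem_set.
- exact: mem_set.
- by move=> x y /set_mem Ax /set_mem Ay; apply/mem_set/AF.
Qed.

Record subgroup (G : groupType) := Subgroup {
  subgroup_set :> set G;
  subgroup_closed : is_subgroup subgroup_set
}.

Definition subgroup_type (G : groupType) (H : subgroup G) : Type :=
  {x : G | x \in subgroup_set H}.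

Section SubgroupType.
Variables (G : groupType) (H : subgroup G).
HB.instance Definition _ := SubType.on (subgroup_type H).
HB.instance Definition _ := [Choice of subgroup_type H by <:].
HB.instance Definition _ :=
  SubChoice_isSubGroup.Build G _ (subgroup_type H) (subgroup_closed H).
End SubgroupType.

Definition finite_index (G : groupType) (H : subgroup G) : Prop :=
  finite_set (range (fun x : G => [set x * h | h in H])).

Definition generated (G : groupType) (S : set G) : set G :=
  smallest (@is_subgroup G) S.

Lemma generated_subgroup (G : groupType) (S : set G) :
  is_subgroup (generated S).
Proof.
apply/is_subgroupP; split.
  by move=> A /= [/is_subgroupP[]].
move=> x y Sx Sy A [sA SA]; have /is_subgroupP[_ AF] := sA.
by apply: AF; [apply: Sx | apply: Sy].
Qed.

Definition normal_closure (G : groupType) (S : set G) : set G :=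
  smallest
    (fun A : set G => is_subgroup A /\ forall x y : G, A x -> A (x ^ y)) S.

Definition finitely_generated (G : groupType) : Prop :=
  exists2 S : set G, finite_set S & generated S = setT.

(* The universal property of a free group with basis i : X -> F. *)
Definition free_on (F : groupType) (X : Type) (i : X -> F) : Prop :=
  forall (K : groupType) (f : X -> K),
    exists2 phi : {multiplicative F -> K},
      (forall x, phi (i x) = f x) &
      forall psi : {multiplicative F -> K},
        (forall x, psi (i x) = f x) -> forall y, psi y = phi y.

Definition is_free (F : groupType) : Prop :=
  exists (X : Type) (i : X -> F), free_on i.

Definition is_abelian (G : groupType) : Prop := forall x y : G, commute x y.

Definition finitely_presented (G : groupType) : Prop :=
  exists (n : nat) (F : groupType) (i : 'I_n -> F)
         (phi : {multiplicative F -> G}) (R : set F),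
    [/\ free_on i, range phi = setT, finite_set R &
        [set x | phi x = 1] = normal_closure R].

Definition is_large (G : groupType) : Prop :=
  exists (H : subgroup G) (F : groupType)
         (phi : {multiplicative subgroup_type H -> F}),
    [/\ finite_index H, is_free F, ~ is_abelian F & range phi = setT].

Definition is_lerf (G : groupType) : Prop :=
  forall H : subgroup G, finitely_generated (subgroup_type H) ->
    exists2 C : set (subgroup G),
      (forall K, C K -> finite_index K) &
      subgroup_set H = \bigcap_(K in C) subgroup_set K.

Definition derived (G : groupType) : set G :=
  generated [set z | exists x y : G, z = [~ x, y]].

Section Abelianization.
Variable G : groupType.
Local Notation D := (@derived G).

Lemma derivedP : D 1 /\ forall x y, D x -> D y -> D (x / y).
Proof. by apply/is_subgroupP; apply: generated_subgroup. Qed.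

Lemma derivedV x : D x -> D x^-1.
Proof. by case: derivedP => D1 DF Dx; rewrite -[x^-1]mul1g; apply: DF. Qed.

Lemma derivedM x y : D x -> D y -> D (x * y).
Proof.
by move=> Dx /derivedV Dy; rewrite -[y]invgK; apply: derivedP.2.
Qed.

Lemma derivedR (x y : G) : D [~ x, y].
Proof. by move=> A [_]; apply; exists x, y. Qed.

Lemma derivedJ x y : D x -> D (x ^ y).
Proof.
move=> Dx; rewrite (_ : x ^ y = x * [~ x, y]); last by rewrite commgEl mulVKg.
by apply: derivedM => //; apply: derivedR.
Qed.

Definition ab_rel (x y : G) : bool := `[< D (x^-1 * y) >].

Lemma ab_rel_refl : reflexive ab_rel.
Proof. by move=> x; apply/asboolP; rewrite mulVg; case: derivedP. Qed.

Lemma ab_rel_sym : symmetric ab_rel.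
Proof.
by move=> x y; apply/asboolP/asboolP => /derivedV; rewrite invgM invgK.
Qed.

Lemma ab_rel_trans : transitive ab_rel.
Proof.
move=> y x z /asboolP xy /asboolP yz; apply/asboolP.
by have := derivedM xy yz; rewrite -mulgA mulVKg.
Qed.

Canonical ab_equiv : equiv_rel G :=
  EquivRel ab_rel ab_rel_refl ab_rel_sym ab_rel_trans.

Definition abelianization : Type := {eq_quot ab_equiv}.
HB.instance Definition _ := Choice.on abelianization.
HB.instance Definition _ := EqQuotient.on abelianization.

Definition ab_zero : abelianization := \pi_abelianization 1.
Definition ab_opp (u : abelianization) : abelianization := \pi_abelianization (repr u)^-1.
Definition ab_add (u v : abelianization) : abelianization :=
  \pi_abelianization (repr u * repr v).

Lemma ab_eqP (x y : G) :
  reflect (D (x^-1 * y)) (\pi_abelianization x == \pi_abelianization y).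
Proof. by rewrite pi_eq_quot; apply: asboolP. Qed.

Lemma ab_repr (x : G) : D ((repr (\pi_abelianization x))^-1 * x).
Proof. by apply/ab_eqP; rewrite reprK. Qed.

Lemma ab_addE (x y : G) :
  ab_add (\pi x) (\pi y) = \pi_abelianization (x * y).
Proof.
apply/eqP/ab_eqP; have Dx := ab_repr x; have Dy := ab_repr y.
set a := repr _ in Dx *; set b := repr _ in Dy *.
have -> : (a * b)^-1 * (x * y) = (a^-1 * x) ^ b * (b^-1 * y).
  by rewrite conjgE invgM -!mulgA mulVKg.
by apply: derivedM => //; apply: derivedJ.
Qed.

Lemma ab_oppE (x : G) : ab_opp (\pi x) = \pi_abelianization x^-1.
Proof.
apply/eqP/ab_eqP; have Dx := ab_repr x; set a := repr _ in Dx *.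
rewrite invgK (_ : a * x^-1 = ((a^-1 * x) ^ a^-1)^-1).
  by apply: derivedV; apply: derivedJ.
by rewrite conjgE invgK mulgA mulVKg invgM invgK ?mulgA.
Qed.

Lemma ab_addA : associative ab_add.
Proof.
move=> u v w; rewrite -[u]reprK -[v]reprK -[w]reprK.
by rewrite !ab_addE mulgA.
Qed.

Lemma ab_addC : commutative ab_add.
Proof.
move=> u v; rewrite -[u]reprK -[v]reprK !ab_addE.
apply/eqP/ab_eqP; rewrite invgM -!mulgA.
exact: derivedR.
Qed.

Lemma ab_add0 : left_id ab_zero ab_add.
Proof. by move=> u; rewrite -[u]reprK ab_addE mul1g. Qed.

Lemma ab_addN : left_inverse ab_zero ab_opp ab_add.
Proof. by move=> u; rewrite -[u]reprK ab_oppE ab_addE mulVg. Qed.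

HB.instance Definition _ :=
  GRing.isZmodule.Build abelianization ab_addA ab_addC ab_add0 ab_addN.
End Abelianization.

Definition z_independent (A : zmodType) (n : nat) (x : 'I_n -> A) : Prop :=
  forall a : 'I_n -> int,
    (\sum_(i < n) x i *~ a i = 0)%R -> forall i, a i = 0%R.

(* Torsion-free rank; the relation holds for no n when the rank is infinite,
   which does not happen for finitely generated groups. *)
Definition has_rank (A : zmodType) (n : nat) : Prop :=
  (exists x : 'I_n -> A, z_independent x) /\
  forall (m : nat) (x : 'I_m -> A), z_independent x -> m <= n.

Definition has_betti1 (G : groupType) (n : nat) : Prop :=
  has_rank (abelianization G) n.

Definition virtual_betti1_zero (G : groupType) : Prop :=
  forall H : subgroup G, finite_index H -> has_betti1 (subgroup_type H) 0.

(* A homomorphism from the additive group int to Aut(L). *)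
Record int_action (L : groupType) := IntAction {
  int_act :> int -> L -> L;
  int_act0 : forall x, int_act 0%R x = x;
  int_actD : forall m n x, int_act (m + n)%R x = int_act m (int_act n x);
  int_actM : forall m, {morph int_act m : x y / x * y}
}.

Definition semidirect (L : groupType) (act : int_action L) : Type :=
  (L * int)%type.

Section Semidirect.
Variables (L : groupType) (act : int_action L).
HB.instance Definition _ := Choice.on (semidirect act).

Definition sd_mul (u v : semidirect act) : semidirect act :=
  (u.1 * act u.2 v.1, (u.2 + v.2)%R).
Definition sd_one : semidirect act := (1, 0%R).
Definition sd_inv (u : semidirect act) : semidirect act :=
  (act (- u.2)%R u.1^-1, (- u.2)%R).

Lemma int_act1 m : act m 1 = 1.
Proof. by apply: (mulgI (act m 1)); rewrite -int_actM !mulg1. Qed.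

Lemma sd_mulA : associative sd_mul.
Proof.
move=> [x m] [y n] [z p].
by rewrite /sd_mul /= int_actM int_actD mulgA GRing.addrA.
Qed.

Lemma sd_mul1 : left_id sd_one sd_mul.
Proof. by case=> x m; rewrite /sd_mul /= int_act0 mul1g GRing.add0r. Qed.

Lemma sd_mulr1 : right_id sd_one sd_mul.
Proof. by case=> x m; rewrite /sd_mul /= int_act1 mulg1 GRing.addr0. Qed.

Lemma sd_mulV : left_inverse sd_one sd_inv sd_mul.
Proof.
by case=> x m; rewrite /sd_mul /= -int_actM mulVg int_act1 GRing.addNr.
Qed.

Lemma sd_mulrV : right_inverse sd_one sd_inv sd_mul.
Proof.
case=> x m.
by rewrite /sd_mul /= -int_actD GRing.addrN int_act0 mulgV.
Qed.

HB.instance Definition _ := isGroup.Build (semidirect act)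
  sd_mulA sd_mul1 sd_mulr1 sd_mulV sd_mulrV.
End Semidirect.

Definition isomorphic (G K : groupType) : Prop :=
  exists phi : {multiplicative G -> K}, bijective phi.

Definition virtually_fg_by_int (G : groupType) : Prop :=
  exists (H : subgroup G) (L : groupType) (act : int_action L),
    [/\ finite_index H, finitely_generated L &
        isomorphic (subgroup_type H) (semidirect act)].

(* Main.v *)
From HB Require Import structures.
From mathcomp Require Import all_boot fingroup perm.
From mathcomp Require Import order ssralg ssrnum ssrint intdiv rat generic_quotient.
From mathcomp Require Import boolp classical_sets cardinality.
Require Import Defs.

(** Let H be a subgroup of finite index of G with positive first Betti number. It
is finitely presented ([locally_presented_sub]), its finitely generated
subgroups are separated from the other elements by finite quotients
([separable_sub]), and there are a homomorphism chi from H onto the integers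
and an element t with chi t = 1 ([int_hom_onto]). By a theorem of Bieri and
Strebel ([bieri_strebel]), H is an HNN extension with stable letter t: there are
subgroups A and B of the kernel of chi, A being contained in B and finitely
generated, such that H is generated by B and t, the conjugate of A by t lies in
B, and these conjugations are the only relations between B and t. The last
point is expressed by the homomorphisms that can be defined on H
([hnn_universal]).

If A = B, then t conjugates A into itself. In each finite quotient the images of
A and of its conjugate have the same order, hence are equal; as finite quotients
separate A from the other elements, t normalizes A ([separable_conj]). Then A is
the kernel of chi, and H is the semidirect product of A and the powers of t
([semidirect_of_conj]).

If A and B differ, there is a homomorphism q to a finite group under which the
image of A is smaller than the image of B. The graph that has the cosets of q B
in the image of q as vertices and the cosets of q A as edges, that of x
joining the vertices of x and of t x, is connected and has at least twice as
many edges as vertices, so it remains connected without two of its edges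
([two_free_edges]). Its fundamental group therefore maps onto the free group F
of rank 2, and so does the kernel of q, which maps onto that fundamental group.
Concretely, the two edges are labelled by the generators of F and the other
edges by 1. Reading labels along paths is a cocycle of H with values in F, in
other words a homomorphism to a wreath product ([label_cocycle]), and on the
kernel of q it restricts to a homomorphism onto F ([large_of_proper]). Largeness
of H passes to G ([is_large_sub]). *)

Set Implicit Arguments.
Unset Strict Implicit.
Unset Printing Implicit Defensive.

Local Open Scope classical_set_scope.
Local Open Scope quotient_scope.
Local Open Scope group_scope.

#[local] Identity Coercion fun_of_set : set >-> Funclass.

(** * Groups, subgroups and homomorphisms *)

Section Hom.
Variables (G K : groupType) (f : {multiplicative G -> K}).

Lemma hom1 : f 1 = 1.
Proof. by apply: (mulgI (f 1)); rewrite -gmulfM !mulg1. Qed.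

Lemma homV : {morph f : x / x^-1}.
Proof. by move=> x; apply: (mulgI (f x)); rewrite -gmulfM !mulgV hom1. Qed.

Lemma homF : {morph f : x y / x / y}.
Proof. by move=> x y; rewrite gmulfM homV. Qed.

Lemma homX n : {morph f : x / x ^+ n}.
Proof. by move=> x; elim: n => [|n IH]; rewrite ?hom1 // !expgS gmulfM IH. Qed.

End Hom.

Section Generated.
Variable G : groupType.
Implicit Types (S A : set G) (x y : G).

Lemma subgroup1 (H : subgroup G) : H 1.
Proof. by case/is_subgroupP: (subgroup_closed H). Qed.

Lemma subgroupF (H : subgroup G) x y : H x -> H y -> H (x / y).
Proof. by case/is_subgroupP: (subgroup_closed H) => _; apply. Qed.

Lemma subgroupV (H : subgroup G) x : H x -> H x^-1.
Proof. by move=> Hx; rewrite -div1g; apply/subgroupF => //; apply: subgroup1. Qed.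

Lemma subgroupM (H : subgroup G) x y : H x -> H y -> H (x * y).
Proof. by move=> Hx /subgroupV Hy; rewrite -[y]invgK; apply: subgroupF. Qed.

Lemma subgroupMl (H : subgroup G) x y : H x -> H (x * y) -> H y.
Proof. by move=> /subgroupV Hx /(subgroupM Hx); rewrite mulKg. Qed.

Definition gen S : subgroup G := Subgroup (generated_subgroup S).

Lemma gen_in S x : S x -> gen S x.
Proof. by move=> Sx A [_]; apply. Qed.

Lemma gen_ind S (P : G -> Prop) :
    (forall x, S x -> P x) -> P 1 ->
    (forall x y, P x -> P y -> P (x / y)) ->
  forall x, gen S x -> P x.
Proof. by move=> SP P1 PF x; apply; split => //; apply/is_subgroupP; split. Qed.

Lemma gen_sub S (H : subgroup G) : S `<=` H -> gen S `<=` H.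
Proof.
move=> SH x; apply: gen_ind => // [|y z]; first exact: subgroup1.
exact: subgroupF.
Qed.

Lemma gen_le S S' : S `<=` S' -> gen S `<=` gen S'.
Proof. by move=> le; apply: gen_sub => x /le; apply: gen_in. Qed.

Lemma gen_ext (K : groupType) (f g : {multiplicative G -> K}) S :
  (forall x, S x -> f x = g x) -> forall x, gen S x -> f x = g x.
Proof.
move=> fg; apply: gen_ind => // [|x y Px Py]; first by rewrite !hom1.
by rewrite !homF Px Py.
Qed.

End Generated.

Lemma genE (G : groupType) (S : set G) : gen S = generated S :> set G.
Proof. by []. Qed.

(* Simplification would otherwise replace the subgroup by its underlying set. *)
#[global] Opaque gen.

Lemma gen_image (G K : groupType) (f : {multiplicative G -> K}) (S : set G) x :
  gen S x -> gen (f @` S) (f x).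
Proof.
move: x; apply: gen_ind => [x Sx||x y Px Py].
- by apply: gen_in; exists x.
- by rewrite hom1; apply: subgroup1.
- by rewrite homF; apply: subgroupF.
Qed.

Section MultiplicativeOf.
Variables (G K : groupType) (f : G -> K).
Hypothesis fM : {morph f : x y / x * y}.
Definition multiplicative_fun (_ : {morph f : x y / x * y}) : G -> K := f.
HB.instance Definition _ := isMultiplicative.Build G K (multiplicative_fun fM) fM.
Definition multiplicative_of : {multiplicative G -> K} := multiplicative_fun fM.
End MultiplicativeOf.

Section FiniteIndex.
Variable G : groupType.

Lemma coset_eq (H : subgroup G) (x y : G) :
  [set x * h | h in H] = [set y * h | h in H] <-> H (x^-1 * y).
Proof.
split=> [E|Hxy].
  have: [set y * h | h in H] y by exists 1; rewrite ?mulg1 //; exact: subgroup1.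
  by rewrite -E => -[h Hh <-]; rewrite mulKg.
have incl z w : H (z^-1 * w) -> [set w * h | h in H] `<=` [set z * h | h in H].
  move=> Hzw _ [h Hh <-]; exists (z^-1 * w * h); first exact: subgroupM.
  by rewrite !mulgA mulgV mul1g.
apply/seteqP; split; apply: incl => //.
by rewrite -[_^-1 * _]invgK invgM invgK; apply: subgroupV.
Qed.

Lemma finite_indexP (H : subgroup G) : finite_index H <->
  exists (V : finType) (j : G -> V), forall x y, j x = j y <-> H (x^-1 * y).
Proof.
split=> [/finite_seqP[s sE]|[V [j jP]]].
  have jin x : [set x * h | h in H] \in s.
    have : [set` s] [set x * h | h in H] by rewrite -sE; exists x.
    by [].
  exists (seq_sub s), (fun x => SeqSub (jin x)) => x y.
  by rewrite -coset_eq; split=> [[]|E] //; apply/val_inj.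
pose F (v : V) := [set x | exists y, j y = v /\ H (y^-1 * x)].
apply: (@sub_finite_set _ _ (F @` setT)); last exact: finite_image.
move=> _ [x _ <-]; exists (j x) => //; apply/seteqP; split=> [z [y [/jP xy Hz]]|].
  exists (x^-1 * z); last by rewrite mulVKg.
  have : H (y^-1 * x) by [].
  by move=> /subgroupV; rewrite invgM invgK => /subgroupM /(_ Hz); rewrite -mulgA mulVKg.
by move=> _ [h Hh <-]; exists x; split=> //; rewrite mulKg.
Qed.

(** The map need only be finer than the partition into left cosets: a coset is
determined by the set of values that the map takes on it. *)
Lemma finite_index_of (H : subgroup G) (V : finType) (j : G -> V) :
  (forall x y, j x = j y -> H (x^-1 * y)) -> finite_index H.
Proof.
move=> jP; pose k x := [set v : V | `[< exists2 y, H y & j (x * y) = v >]]%SET.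
apply/finite_indexP; exists {set V}, k => x y; split=> [/setP/(_ (j y))|Hxy].
  rewrite !inE => kxy; have : `[< exists2 z, H z & j (y * z) = j y >].
    by apply/asboolP; exists 1; rewrite ?mulg1//; apply: subgroup1.
  rewrite -kxy => /asboolP[z Hz /jP]; rewrite invgM -mulgA => h.
  by have := subgroupM Hz h; rewrite mulVKg.
apply/setP => v; rewrite !inE; apply/asboolP/asboolP => -[z Hz <-].
  exists (y^-1 * x * z); last by rewrite !mulgA mulgV mul1g.
  by apply: subgroupM => //; rewrite -[_ * _]invgK invgM invgK; apply: subgroupV.
by exists (x^-1 * y * z); [apply: subgroupM | rewrite !mulgA mulgV mul1g].
Qed.

End FiniteIndex.

Section SubgroupType.
Variables (G : groupType) (H : subgroup G).

Definition incl : {multiplicative subgroup_type H -> G} := val.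

Lemma incl_inj : injective incl.
Proof. exact: val_inj. Qed.

Lemma inclP x : H (incl x).
Proof. exact: set_mem (valP x). Qed.

Definition insubg (x : G) : subgroup_type H := insubd 1 x.

Lemma insubgK x : H x -> incl (insubg x) = x.
Proof. by move=> Hx; rewrite /incl /= val_insubd mem_set. Qed.

Lemma inclK : cancel incl insubg.
Proof. by move=> x; apply/incl_inj; rewrite insubgK //; apply: inclP. Qed.

Lemma insubgM x y : H x -> H y -> insubg (x * y) = insubg x * insubg y.
Proof.
by move=> Hx Hy; apply/incl_inj; rewrite gmulfM !insubgK//; apply: subgroupM.
Qed.

Lemma insubgV x : H x -> insubg x^-1 = (insubg x)^-1.
Proof.
by move=> Hx; apply/incl_inj; rewrite homV !insubgK//; apply: subgroupV.
Qed.

Lemma insubg1 : insubg 1 = 1.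
Proof. by rewrite -[in LHS](hom1 incl) inclK. Qed.

End SubgroupType.

Arguments incl {G H}.
Arguments insubg {G} H x.
#[global] Opaque incl.

(** The generated subgroup, taken as a group of its own, is generated by the same
elements. *)
Lemma gen_subgroup_type (G : groupType) (S : set G) (x : subgroup_type (gen S)) :
  gen (@incl _ (gen S) @^-1` S) x.
Proof.
suff : forall y, gen S y -> exists2 z : subgroup_type (gen S),
    incl z = y & gen (@incl _ (gen S) @^-1` S) z.
  by move=> /(_ _ (inclP x))[z /incl_inj->].
apply: gen_ind => [y Sy||y z [y' <- gy] [z' <- gz]].
- exists (insubg (gen S) y); first by rewrite insubgK//; apply: gen_in.
  by apply: gen_in; rewrite /preimage /mkset insubgK//; apply: gen_in.
- by exists 1; rewrite ?hom1//; apply: subgroup1.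
- by exists (y' / z'); [rewrite homF | apply: subgroupF].
Qed.

Lemma fg_gen (G : groupType) (S : seq G) :
  finitely_generated (subgroup_type (gen [set` S])).
Proof.
exists (@incl _ (gen [set` S]) @^-1` [set` S]).
  apply: finite_preimage; last exact: finite_seq.
  by move=> x y _ _ /incl_inj.
by rewrite -genE; apply/seteqP; split=> // x _; apply: gen_subgroup_type.
Qed.

(** * Words and free groups *)

Section Words.
Variable X : Type.
Definition word := seq (X * bool).

Definition letter (K : groupType) (f : X -> K) (l : X * bool) : K :=
  if l.2 then (f l.1)^-1 else f l.1.

Definition evalw (K : groupType) (f : X -> K) (w : word) : K :=
  foldr (fun l u => letter f l * u) 1 w.

Definition invw (w : word) : word := rev [seq (l.1, ~~ l.2) | l <- w].

Lemma evalw_cat (K : groupType) (f : X -> K) (u v : word) :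
  evalw f (u ++ v) = evalw f u * evalw f v.
Proof. by elim: u => [|l u IH] /=; rewrite ?mul1g // IH mulgA. Qed.

Lemma evalw_inv (K : groupType) (f : X -> K) (w : word) :
  evalw f (invw w) = (evalw f w)^-1.
Proof.
elim: w => [|[x b] w IH] /=; first by rewrite invg1.
rewrite /invw /= rev_cons -cats1 evalw_cat IH invgM /= mulg1.
by case: b; rewrite /letter /= ?invgK.
Qed.

Lemma evalw_hom (K L : groupType) (g : {multiplicative K -> L}) (f : X -> K) w :
  g (evalw f w) = evalw (g \o f) w.
Proof.
elim: w => [|[x b] w IH] /=; first exact: hom1.
by rewrite gmulfM IH; case: b; rewrite /letter /= ?homV.
Qed.

End Words.

Section FreeGroup.
Variable X : choiceType.

(** Two words are identified when no assignment of letters in any group tells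
them apart, which makes the universal property of the quotient immediate. *)
Definition free_rel (u v : word X) : bool :=
  `[< forall (K : groupType) (f : X -> K), evalw f u = evalw f v >].

Lemma free_rel_refl : reflexive free_rel.
Proof. by move=> u; apply/asboolP. Qed.

Lemma free_rel_sym : symmetric free_rel.
Proof. by move=> u v; apply/asboolP/asboolP => E K f; rewrite E. Qed.

Lemma free_rel_trans : transitive free_rel.
Proof.
by move=> v u w /asboolP uv /asboolP vw; apply/asboolP => K f; rewrite uv.
Qed.

Canonical free_equiv : equiv_rel (word X) :=
  EquivRel free_rel free_rel_refl free_rel_sym free_rel_trans.

Definition free_group : Type := {eq_quot free_equiv}.
HB.instance Definition _ := Choice.on free_group.
HB.instance Definition _ := EqQuotient.on free_group.

Implicit Types a b c : free_group.

Lemma free_eqP (u v : word X) :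
  (forall (K : groupType) (f : X -> K), evalw f u = evalw f v) <->
  \pi_free_group u = \pi_free_group v.
Proof.
split=> [E|/eqP]; last by rewrite pi_eq_quot => /asboolP.
by apply/eqP; rewrite pi_eq_quot; apply/asboolP.
Qed.

Definition evalf (K : groupType) (f : X -> K) a : K := evalw f (repr a).

Lemma evalf_pi (K : groupType) (f : X -> K) w :
  evalf f (\pi_free_group w) = evalw f w.
Proof.
suff /free_eqP : \pi_free_group (repr (\pi_free_group w)) = \pi_free_group w by apply.
by rewrite reprK.
Qed.

Lemma evalf_ext a b :
  (forall (K : groupType) (f : X -> K), evalf f a = evalf f b) -> a = b.
Proof. by move=> E; rewrite -[a]reprK -[b]reprK; apply/free_eqP. Qed.

Definition free_one : free_group := \pi_free_group [::].
Definition free_mul a b : free_group := \pi_free_group (repr a ++ repr b).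
Definition free_inv a : free_group := \pi_free_group (invw (repr a)).

Lemma evalfM (K : groupType) (f : X -> K) :
  {morph evalf f : a b / free_mul a b >-> a * b}.
Proof. by move=> a b; rewrite evalf_pi evalw_cat. Qed.

Lemma evalfV (K : groupType) (f : X -> K) : {morph evalf f : a / free_inv a >-> a^-1}.
Proof. by move=> a; rewrite evalf_pi evalw_inv. Qed.

Lemma evalf1 (K : groupType) (f : X -> K) : evalf f free_one = 1.
Proof. by rewrite evalf_pi. Qed.

Definition evalfE := (evalfM, evalfV, evalf1).

Lemma free_mulA : associative free_mul.
Proof. by move=> a b c; apply: evalf_ext => K f; rewrite !evalfE mulgA. Qed.
Lemma free_mul1 : left_id free_one free_mul.
Proof. by move=> a; apply: evalf_ext => K f; rewrite !evalfE mul1g. Qed.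
Lemma free_mulr1 : right_id free_one free_mul.
Proof. by move=> a; apply: evalf_ext => K f; rewrite !evalfE mulg1. Qed.
Lemma free_mulV : left_inverse free_one free_inv free_mul.
Proof. by move=> a; apply: evalf_ext => K f; rewrite !evalfE mulVg. Qed.
Lemma free_mulrV : right_inverse free_one free_inv free_mul.
Proof. by move=> a; apply: evalf_ext => K f; rewrite !evalfE mulgV. Qed.

HB.instance Definition _ := isGroup.Build free_group
  free_mulA free_mul1 free_mulr1 free_mulV free_mulrV.

Definition free_gen (x : X) : free_group := \pi_free_group [:: (x, false)].

Lemma evalf_gen (K : groupType) (f : X -> K) x : evalf f (free_gen x) = f x.
Proof. by rewrite evalf_pi /= mulg1. Qed.

Lemma free_groupE (w : word X) : \pi_free_group w = evalw free_gen w.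
Proof.
apply: evalf_ext => K f; rewrite evalf_pi.
rewrite -[evalf f]/(multiplicative_of (evalfM f) : _ -> _) evalw_hom.
by congr evalw; apply/funext => x; rewrite /= -[RHS]/(evalf f _) evalf_gen.
Qed.

Lemma free_on_free_group : free_on free_gen.
Proof.
move=> K f; exists (multiplicative_of (evalfM f)) => [x|psi psif y].
  exact: evalf_gen.
rewrite -[y]reprK free_groupE !evalw_hom; congr evalw; apply/funext => x /=.
by rewrite psif; apply/esym/evalf_gen.
Qed.

Lemma gen_free_group a : gen (range free_gen) a.
Proof.
rewrite -[a]reprK free_groupE; elim: (repr a) => [|[x b] w IH] /=.
  exact: subgroup1.
apply: subgroupM => //; have : gen (range free_gen) (free_gen x).
  by apply: gen_in; exists x.
by case: b => // xw; apply: subgroupV.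
Qed.

End FreeGroup.

(** Two transpositions of three points do not commute. *)
Lemma free_group_nonabelian : ~ is_abelian (free_group bool).
Proof.
pose i0 : 'I_3 := ord0; pose i1 : 'I_3 := inord 1; pose i2 : 'I_3 := ord_max.
pose f (b : bool) : {perm 'I_3} := if b then tperm i0 i1 else tperm i0 i2.
have i1E : val i1 = 1%N by rewrite /i1 /= inordK.
move=> /(_ (free_gen true) (free_gen false)) /(congr1 (evalf f)).
rewrite !evalfM !evalf_gen /f => /permP/(_ i0).
rewrite !permM !tpermL !tpermD -?val_eqE ?i1E //.
by move=> /(congr1 val); rewrite i1E.
Qed.

(** * Finite presentations as multiplication tables *)

Definition partial_hom (G P : groupType) (M : seq G) (f : G -> P) :=
  {in M &, forall x y, x * y \in M -> f (x * y) = f x * f y}.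

(** Finite presentability without a choice of generators: arbitrarily large
finite pieces of the multiplication table present the group. This form is handy
because neither a change of generators nor the passage to a subgroup of finite
index involves rewriting words. *)
Definition locally_presented (G : groupType) : Prop :=
  forall S : seq G, exists M : seq G,
    [/\ {subset S <= M}, forall x, gen [set` M] x &
        forall (P : groupType) (f : G -> P), partial_hom M f ->
          exists phi : {multiplicative G -> P}, {in M, phi =1 f}].

Section PartialHom.
Variables (G P : groupType) (M : seq G) (f : G -> P).
Hypotheses (fM : partial_hom M f) (M1 : 1 \in M).

Lemma partial_hom1 : f 1 = 1.
Proof. by apply: (mulgI (f 1)); rewrite -fM ?mulg1. Qed.

Lemma partial_homV x : x \in M -> x^-1 \in M -> f x^-1 = (f x)^-1.
Proof.
by move=> Mx Mx'; apply: (mulgI (f x)); rewrite -fM ?mulgV // partial_hom1.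
Qed.

End PartialHom.

(** Both the identity and the retraction of F onto the subgroup generated by the
basis extend the inclusion of the basis, so they are equal. *)
Lemma free_on_gen (F : groupType) (X : Type) (i : X -> F) :
  free_on i -> forall y, gen (range i) y.
Proof.
move=> Fi y; pose j x := insubg (gen (range i)) (i x).
have jE x : incl (j x) = i x by rewrite insubgK //; apply: gen_in; exists x.
have [phi phiE _] := Fi _ j; have [psi _ psiU] := Fi _ i.
have <- : incl (phi y) = y.
  have -> : incl (phi y) = psi y.
    by apply: (psiU (incl \o phi)) => x /=; rewrite phiE jE.
  by apply/esym; apply: (psiU idfun).
exact: inclP.
Qed.

Lemma gen_range_word (F : groupType) (X : Type) (i : X -> F) y :
  gen (range i) y -> exists w, evalw i w = y.
Proof.
move: y; apply: gen_ind => [_ [x _ <-]||_ _ [u <-] [v <-]].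
- by exists [:: (x, false)]; rewrite /= mulg1.
- by exists [::].
- by exists (u ++ invw v); rewrite evalw_cat evalw_inv.
Qed.

(** The table records the values of all the suffixes of the relators, of the
one-letter words and of words for the prescribed elements S. A partial
homomorphism can then evaluate a relator letter by letter, so it kills the
relators. *)
Lemma locally_presented_fp (G : groupType) :
  finitely_presented G -> locally_presented G.
Proof.
move=> [n [F [i [phi [R [Fi phiT /finite_seqP[r rR] kerE]]]]]] S.
have wordF y : exists w, evalw i w = y by apply: gen_range_word; apply: (free_on_gen Fi).
have phi_onto g : exists y, phi y = g.
  by have : setT g by []; rewrite -phiT => -[y _ <-]; exists y.
pose wF y := projT1 (cid (wordF y)).
have wFE y : evalw i (wF y) = y by rewrite /wF; case: cid.
pose lift g := projT1 (cid (phi_onto g)).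
have liftE g : phi (lift g) = g by rewrite /lift; case: cid.
pose x := phi \o i.
have xE w : evalw x w = phi (evalw i w) by rewrite evalw_hom.
(* W is closed under suffixes, so that partial homomorphisms on M can be
   computed by induction on the words of W. *)
pose L := [seq wF y | y <- r] ++ [seq wF (lift g) | g <- S]
  ++ [seq [:: l] | l : 'I_n * bool] ++ [:: [::]].
pose W := flatten [seq [seq drop k w | k <- iota 0 (size w).+1] | w <- L].
pose M := [seq evalw x w | w <- W].
have dropW w k : w \in L -> drop k w \in W.
  move=> Lw; apply/flatten_mapP; exists w => //.
  have [lek|ltk] := leqP k (size w); first by apply/mapP; exists k; rewrite // mem_iota.
  apply/mapP; exists (size w); first by rewrite mem_iota /=.
  by rewrite drop_size drop_oversize // ltnW.
have LW w : w \in L -> w \in W by move=> /(dropW _ 0%N); rewrite drop0.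
have W0 : [::] \in W by apply: LW; rewrite !mem_cat mem_seq1 eqxx !orbT.
have Wl l : [:: l] \in W.
  by apply: LW; rewrite !mem_cat (codom_f (fun l => [:: l])) ?orbT.
have W_cons l w : l :: w \in W -> w \in W.
  move=> /flatten_mapP[v Lv /mapP[k]]; rewrite mem_iota /= => ltk E.
  suff -> : w = drop k.+1 v by apply: dropW.
  by rewrite -addn1 addnC -drop_drop -E /= drop0.
have WM w : w \in W -> evalw x w \in M by apply: map_f.
have xM l : letter x l \in M by have := WM _ (Wl l); rewrite /= mulg1.
exists M; split=> [g Sg|g|P f fM].
- rewrite -[g]liftE -[lift g]wFE -xE.
  by apply/WM/LW; rewrite !mem_cat (map_f (wF \o lift)) ?orbT.
- rewrite -[g]liftE -[lift g]wFE -xE; elim: (wF _) => [|l w IH].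
    exact: subgroup1.
  by apply: subgroupM IH; apply: gen_in; apply: xM.
have M1 : 1 \in M by apply: (WM [::]).
have fx l : f (letter x l) = letter (f \o x) l.
  case: l => j [] //; rewrite /letter /=.
  by apply: partial_homV (xM (j, false)) (xM (j, true)).
have fW w : w \in W -> f (evalw x w) = evalw (f \o x) w.
  elim: w => [|l w IH] Ww /=; first exact: partial_hom1 M1.
  have Ww' := W_cons _ _ Ww.
  by rewrite fM ?xM ?WM ?IH ?fx // -[letter x l * _]/(evalw x (l :: w)) WM.
have [psi psiE _] := Fi _ (f \o x).
have psiW w : w \in W -> psi (evalw i w) = f (evalw x w).
  by move=> /fW->; rewrite evalw_hom; congr evalw; apply/funext.
have ker_le y : phi y = 1 -> psi y = 1.
  suff: normal_closure R y -> psi y = 1 by rewrite -kerE.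
  move=> /(_ [set z | psi z = 1]); apply; split=> [|z Rz /=]; last first.
    have Lz : wF z \in L by rewrite !mem_cat map_f //; move: Rz; rewrite rR.
    rewrite -[z]wFE psiW ?LW // xE wFE.
    suff -> : phi z = 1 by apply: partial_hom1 M1.
    have : normal_closure R z by move=> A [_]; apply.
    by rewrite -kerE.
  split=> [|y1 y2 /= y1E]; last by rewrite gmulfM gmulfM y1E mul1g -gmulfM mulVg hom1.
  by apply/is_subgroupP; split=> [|y1 y2 /= h1 h2]; [exact: hom1|rewrite homF h1 h2 mulgV].
have psi_phi y y' : phi y = phi y' -> psi y = psi y'.
  move=> E; apply/divg1_eq; rewrite -homF; apply: ker_le.
  by rewrite homF E mulgV.
have thM : {morph psi \o lift : g h / g * h}.
  by move=> g h /=; rewrite -gmulfM; apply: psi_phi; rewrite gmulfM !liftE.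
exists (multiplicative_of thM) => _ /mapP[w Ww ->].
by rewrite -psiW // -[LHS]/(psi (lift _)) xE; apply: psi_phi; rewrite liftE.
Qed.

(** * Wreath products and cocycles *)

Section Wreath.
Variables (P Gamma : groupType).

(** The unrestricted regular wreath product. *)
Definition wreath : Type := (Gamma * (Gamma -> P))%type.
HB.instance Definition _ := gen_eqMixin wreath.
HB.instance Definition _ := gen_choiceMixin wreath.

Definition wr_mul (u v : wreath) : wreath :=
  (u.1 * v.1, fun x => u.2 (v.1 * x) * v.2 x).
Definition wr_one : wreath := (1, fun=> 1).
Definition wr_inv (u : wreath) : wreath :=
  (u.1^-1, fun x => (u.2 (u.1^-1 * x))^-1).

Lemma wr_mulA : associative wr_mul.
Proof.
move=> [g c] [h d] [k e]; rewrite /wr_mul /= mulgA; congr pair.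
by apply/funext => x; rewrite !mulgA.
Qed.

Lemma wr_mul1 : left_id wr_one wr_mul.
Proof.
by case=> g c; rewrite /wr_mul /= mul1g; congr pair; apply/funext=> x; rewrite mul1g.
Qed.

Lemma wr_mulr1 : right_id wr_one wr_mul.
Proof.
case=> g c; rewrite /wr_mul /= mulg1; congr pair.
by apply/funext=> x; rewrite mulg1 mul1g.
Qed.

Lemma wr_mulV : left_inverse wr_one wr_inv wr_mul.
Proof.
case=> g c; rewrite /wr_mul /= mulVg; congr pair.
by apply/funext=> x; rewrite mulKg mulVg.
Qed.

Lemma wr_mulrV : right_inverse wr_one wr_inv wr_mul.
Proof.
case=> g c; rewrite /wr_mul /= mulgV; congr pair.
by apply/funext=> x; rewrite mulgV.
Qed.

HB.instance Definition _ := isGroup.Build wreath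
  wr_mulA wr_mul1 wr_mulr1 wr_mulV wr_mulrV.

Lemma wr_mulE (u v : wreath) : u * v = (u.1 * v.1, fun x => u.2 (v.1 * x) * v.2 x).
Proof. by []. Qed.

Lemma wr_fstM : {morph (fun u : wreath => u.1) : u v / u * v}.
Proof. by []. Qed.

End Wreath.

(** The condition says that g |-> (g, c g) is a homomorphism to the wreath
product. Reading c g x as the label of a path from x to g x, it says that labels
multiply along paths. *)
Definition cocycle (Gamma P : groupType) (c : Gamma -> Gamma -> P) : Prop :=
  forall g h v, c (g * h) v = c g (h * v) * c h v.

Section Cocycle.
Variables (Gamma P : groupType) (c : Gamma -> Gamma -> P).
Hypothesis cC : cocycle c.

Lemma cocycle1 v : c 1 v = 1.
Proof.
by have := cC 1 1 v; rewrite !mul1g => E; apply: (mulgI (c 1 v)); rewrite -E mulg1.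
Qed.

Lemma cocycleV g v : c g^-1 v = (c g (g^-1 * v))^-1.
Proof.
apply: (mulgI (c g (g^-1 * v))); rewrite -cC !mulgV; exact: cocycle1.
Qed.

Lemma cocycle_invar (S : set Gamma) (H : Gamma -> Prop) :
  (forall g, S g -> forall v h, H h -> c g (v * h) = c g v) ->
  forall g, gen S g -> forall v h, H h -> c g (v * h) = c g v.
Proof.
move=> SH; apply: gen_ind => // [v h _|x y xH yH v h Hh]; first by rewrite !cocycle1.
by rewrite !cC !cocycleV !mulgA (xH _ _ Hh) (yH _ _ Hh).
Qed.

(** Invariance makes c x depend on cosets only, so that a cocycle becomes a
homomorphism on the elements that fix the coset of 1. *)
Lemma cocycle_hom (H : subgroup Gamma) :
  (forall g v h, H h -> c g (v * h) = c g v) ->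
  forall x y, H x -> H y -> c (x * y) 1 = c x 1 * c y 1.
Proof. by move=> cH x y Hx Hy; rewrite cC mulg1 -{1}[y]mul1g cH. Qed.

End Cocycle.

Lemma wreath_cocycle (G P : groupType) (S : set G)
    (phi : {multiplicative G -> wreath P G}) :
    (forall x, gen S x) -> (forall x, S x -> (phi x).1 = x) ->
  cocycle (fun g => (phi g).2).
Proof.
move=> genS phiS g h v; suff fst x : (phi x).1 = x by rewrite gmulfM wr_mulE /= fst.
exact: (gen_ext (f := multiplicative_of (@wr_fstM P G) \o phi) (g := idfun) phiS).
Qed.

(** * Subgroups of finite index are finitely presented *)

Section FiniteIndexPresented.
Variables (G : groupType) (H : subgroup G).

Lemma transversal : finite_index H ->
  exists (rho : G -> G) (T : seq G),
    [/\ forall g, rho g \in T, forall g, H ((rho g)^-1 * g),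
        forall g h, H h -> rho (g * h) = rho g & rho 1 = 1].
Proof.
move=> /finite_indexP[V [j jP]].
pose rep v := if `[< j 1 = v >] then 1 else
  if pselect (exists g, j g = v) is left ex then projT1 (cid ex) else 1.
have jrep g : j (rep (j g)) = j g.
  rewrite /rep; case: asboolP => [//|_].
  by case: pselect => [ex|[]]; [case: cid | exists g].
exists (rep \o j), [seq rep v | v : V]; split=> [g|g|g h Hh|] /=.
- exact: codom_f.
- exact/jP.
- by congr rep; apply/jP; rewrite invgM -mulgA mulVg mulg1; apply: subgroupV.
- by rewrite /rep; case: asboolP.
Qed.

(** The multiplication table of H consists of the Schreier elements
rho(m v)^-1 m rho(v). They form a cocycle of G with values in H; composing it
with a partial homomorphism f on H gives a partial homomorphism from G to the
wreath product of the target of f by G, that is, f induced to G. It extends to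
G, and the value at 1 of the cocycle so obtained extends f. *)
Lemma locally_presented_sub : finite_index H ->
  locally_presented G -> locally_presented (subgroup_type H).
Proof.
move=> /transversal[rho [T [rhoT rhoP rhoH rho1]]] Gfp S.
have [M [SM genM Mfp]] := Gfp ([seq incl x | x <- S] ++ T).
have MT s : s \in T -> s \in M by move=> Ts; apply: SM; rewrite mem_cat Ts orbT.
have rho_rho g : rho (rho g) = rho g.
  by rewrite -[in RHS](mulVKg (rho g) g) (rhoH _ _ (rhoP g)).
have rho_mul m v : rho (m * rho v) = rho (m * v).
  by rewrite -[in RHS](mulVKg (rho v) v) mulgA (rhoH _ _ (rhoP v)).
have rhoHE h : H h -> rho h = 1 by move=> Hh; rewrite -[h]mul1g rhoH.
pose sch m v := insubg H ((rho (m * v))^-1 * m * rho v).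
have schE m v : incl (sch m v) = (rho (m * v))^-1 * m * rho v.
  by rewrite insubgK // -mulgA -rho_mul.
have schrho m v : sch m (rho v) = sch m v.
  by apply/incl_inj; rewrite !schE rho_mul rho_rho.
have sch_cocycle m m' v : sch (m * m') v = sch m (m' * v) * sch m' v.
  by apply/incl_inj; rewrite gmulfM !schE !mulgA mulgK.
pose N := [seq sch m s | m <- M, s <- T].
have N_sch m v : m \in M -> sch m v \in N.
  by move=> Mm; rewrite -schrho; apply/allpairsP; exists (m, rho v); split; rewrite /= ?rhoT.
have sch1 h : H h -> sch h 1 = insubg H h.
  by move=> Hh; rewrite /sch rho1 !mulg1 rhoHE // invg1 mul1g.
exists N; split=> [x Sx|x|P f fN].
- rewrite -[x]inclK -sch1; last exact: inclP.
  by apply/N_sch/SM; rewrite mem_cat map_f.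
- suff gN g : forall v, gen [set` N] (sch g v).
    by rewrite -[x]inclK -sch1; [apply: gN|apply: inclP].
  move: g (genM g); apply: gen_ind => [m Mm v||g g' gN gN' v].
  + by apply: gen_in; apply: N_sch.
  + move=> v; suff -> : sch 1 v = 1 by apply: subgroup1.
    exact: (cocycle1 sch_cocycle).
  + rewrite sch_cocycle.
    have -> : sch g'^-1 v = (sch g' (g'^-1 * v))^-1.
      by rewrite (cocycleV sch_cocycle).
    by apply: subgroupF.
pose F m : wreath P G := (m, fun v => f (sch m v)).
have [m m' Mm Mm' Mmm'|phi phiE] := Mfp _ F.
  rewrite /F wr_mulE /=; congr pair; apply/funext => v.
  by rewrite sch_cocycle fN // ?N_sch // -sch_cocycle N_sch.
pose c g := (phi g).2.
have cC : cocycle c by apply: wreath_cocycle genM _ => m Mm; rewrite phiE.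
have cE : {in M, forall m, c m = fun v => f (sch m v)}.
  by move=> m Mm; rewrite /c phiE.
have cinv g v h : H h -> c g (v * h) = c g v.
  apply: (cocycle_invar cC (S := [set` M]) _ (genM g)) => m Mm w k Hk.
  rewrite cE // -[in LHS]schrho; congr f.
  by rewrite rhoH // schrho.
have psiM : {morph (fun x : subgroup_type H => c (incl x) 1) : x y / x * y}.
  by move=> x y /=; rewrite gmulfM (cocycle_hom cC cinv) //; apply: inclP.
exists (multiplicative_of psiM) => _ /allpairsP[[m s] [/= Mm Ts ->]].
have N1 : 1 \in N.
  rewrite -(cocycle1 sch_cocycle 1); apply: N_sch; apply: MT.
  by rewrite -rho1 rhoT.
have f1 : f 1 = 1 by apply: partial_hom1 N1.
have crho v : c (rho v) 1 = 1.
  rewrite cE ?MT // (_ : sch _ _ = 1) //.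
  by apply/incl_inj; rewrite schE rho1 !mulg1 rho_rho mulVg hom1.
(* The path from 1 to 1 with value sch m s runs through s and rho(m s); only its
   middle part, the step by m, has a label other than 1. *)
rewrite -[LHS]/(c (incl (sch m s)) 1) schE -mulgA cC cocycleV //.
rewrite mulg1; set u := rho (m * s); have Hk : H (u^-1 * (m * rho s)).
  by rewrite /u -rho_mul.
rewrite -[u^-1 * _]mul1g cinv // crho invg1 mul1g cC crho !mulg1.
by rewrite cE // schrho.
Qed.

End FiniteIndexPresented.

(** * Separation in finite quotients *)

(** Subgroup separability in terms of homomorphisms to finite groups, which
restrict to subgroups by composition with the inclusion. *)
Definition separable (G : groupType) : Prop :=
  forall (S : seq G) (b : G), ~ gen [set` S] b ->
    exists (Q : finGroupType) (q : {multiplicative G -> Q}),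
      forall a, gen [set` S] a -> q a <> q b.

(** The elements that fix the trivial coset in the permutation representation on
the left cosets of K are those of K. *)
Lemma coset_action (G : groupType) (K : subgroup G) : finite_index K ->
  exists (Q : finGroupType) (q : {multiplicative G -> Q}),
    forall a b, K a -> q a = q b -> K b.
Proof.
move=> /finite_indexP[V [j jP]].
pose act g v := if pselect (exists x, j x = v) is left ex
  then j (g * projT1 (cid ex)) else v.
have actE g x : act g (j x) = j (g * x).
  rewrite /act; case: pselect => [ex|[]]; last by exists x.
  case: cid => y /= /jP yx; apply/jP.
  by rewrite invgM -mulgA mulKg.
have actC g v : ~ (exists x, j x = v) -> act g v = v.
  by rewrite /act; case: pselect.
have act1 v : act 1 v = v.
  by case: (pselect (exists x, j x = v)) => [[x <-]|/actC->//]; rewrite actE mul1g.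
have actM g h v : act (g * h) v = act g (act h v).
  case: (pselect (exists x, j x = v)) => [[x <-]|vj]; first by rewrite !actE mulgA.
  by rewrite !actC.
have act_inj g : injective (act g).
  by apply: (can_inj (g := act g^-1)) => v; rewrite -actM mulVg act1.
(* Permutations compose from left to right, hence the inverse. *)
pose q g := perm (act_inj g^-1).
have qM : {morph q : g h / g * h}.
  by move=> g h; apply/permP => v; rewrite permM !permE invgM actM.
exists {perm V}, (multiplicative_of qM) => a b Ka /permP/(_ (j 1)).
rewrite !permE !actE !mulg1 => /jP; rewrite invgK => Kab.
by rewrite -[b]invgK; apply: subgroupV; apply: subgroupMl Ka Kab.
Qed.

Lemma separable_lerf (G : groupType) : is_lerf G -> separable G.
Proof.
move=> lerfG S b nSb; have [C Cfin CE] := lerfG _ (fg_gen S).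
have SC x : gen [set` S] x <-> forall K, C K -> K x by rewrite CE.
have [K CK nKb] : exists2 K, C K & ~ K b.
  apply: contrapT => nK; apply: nSb; apply/SC => K CK.
  by apply: contrapT => nKb; apply: nK; exists K.
have [Q [q qP]] := coset_action (Cfin K CK).
by exists Q, q => a /SC/(_ K CK) Ka /(qP _ _ Ka).
Qed.

Lemma separable_sub (G : groupType) (H : subgroup G) :
  separable G -> separable (subgroup_type H).
Proof.
move=> sepG S b nSb.
have genE x : gen [set` [seq incl y | y <- S]] (incl x) -> gen [set` S] x.
  move=> Sx; suff: exists2 y, gen [set` S] y & incl y = incl x.
    by case=> y Sy /incl_inj <-.
  move: (incl x) Sx; apply: gen_ind => [_ /mapP[y Sy ->]||_ _ [y Sy <-] [z Sz <-]].
  - by exists y => //; apply: gen_in.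
  - by exists 1; rewrite ?hom1 //; apply: subgroup1.
  - by exists (y / z); rewrite ?homF //; apply: subgroupF.
have [//|Q [q qP]] := sepG [seq incl y | y <- S] (incl b); first by move=> /genE.
exists Q, (q \o incl) => a Sa; apply: qP.
have := gen_image (f := incl) Sa; apply: gen_le => _ [y Sy <-]; exact: map_f.
Qed.

(** * Largeness and subgroups of finite index *)

Lemma is_large_of (G : groupType) (K : subgroup G) (F : groupType) (f : G -> F) :
    finite_index K -> is_free F -> ~ is_abelian F ->
    (forall x y, K x -> K y -> f (x * y) = f x * f y) ->
    (forall z, exists2 x, K x & f x = z) ->
  is_large G.
Proof.
move=> finK freeF nabF fM f_onto.
have phiM : {morph (fun x : subgroup_type K => f (incl x)) : x y / x * y}.
  by move=> x y /=; rewrite gmulfM fM //; apply: inclP.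
exists K, F, (multiplicative_of phiM); split=> //.
apply/seteqP; split=> // z _; have [x Kx <-] := f_onto z.
by exists (insubg K x) => //; rewrite -[LHS]/(f (incl _)) insubgK.
Qed.

Lemma is_large_sub (G : groupType) (H : subgroup G) :
  finite_index H -> is_large (subgroup_type H) -> is_large G.
Proof.
move=> finH [K [F [phi [finK freeF nabF phiT]]]].
have LP : is_subgroup [set x | H x /\ K (insubg H x)].
  apply/is_subgroupP; split=> [|x y [Hx Kx] [Hy Ky]].
    split; first exact: subgroup1.
    by rewrite insubg1; apply: subgroup1.
  split; first exact: subgroupF.
  by rewrite insubgM ?insubgV //; [apply: subgroupF | apply: subgroupV].
pose L := Subgroup LP.
apply: (@is_large_of G L F (fun x => phi (insubg K (insubg H x)))) => //.
- have /finite_indexP[V [j jP]] := finH; have /finite_indexP[W [k kP]] := finK.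
  have [rho [_ [_ rhoP rhoH _]]] := transversal finH.
  (* The coset of x modulo L is determined by the representative rho x of its
     coset modulo H and by the coset of rho(x)^-1 x modulo K. *)
  apply: (@finite_index_of _ L (V * W)%type
      (fun x => (j x, k (insubg H ((rho x)^-1 * x))))) => x y [/jP Hxy].
  have -> : rho x = rho y by rewrite -[y](mulVKg x) rhoH.
  have Hy := rhoP y; have Hx : H ((rho y)^-1 * x).
    rewrite -[x](mulVKg y) mulgA; apply: subgroupM => //.
    by rewrite -[_ * _]invgK invgM invgK; apply: subgroupV.
  move=> /kP; rewrite -insubgV // -insubgM //; last exact: subgroupV.
  by rewrite invgM invgK -mulgA mulVKg.
- move=> x y [Hx Kx] [Hy Ky].
  by rewrite insubgM // insubgM // gmulfM.
- move=> z; have : setT z by []. rewrite -phiT => -[x _ <-].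
  exists (incl (incl x)); last by rewrite !inclK.
  by split; [apply: inclP | rewrite inclK; apply: inclP].
Qed.

(** * Homomorphisms onto the integers *)

Section ExtendHom.
Import GRing.Theory Num.Theory Order.TTheory.
Local Open Scope ring_scope.
Variable A : zmodType.

(** Graphs of homomorphisms from subgroups of A to the rationals: subgroups of
the product that meet the second factor trivially. *)
Definition hom_graph (T : A -> rat -> Prop) : Prop :=
  (forall x r y s, T x r -> T y s -> T (x - y) (r - s)) /\
  (forall r, T 0 r -> r = 0).

Section HomGraph.
Variable T : A -> rat -> Prop.
Hypothesis homT : hom_graph T.

Lemma hom_graph0 x r : T x r -> T 0 0.
Proof. by move=> Tx; have := homT.1 _ _ _ _ Tx Tx; rewrite !subrr. Qed.

Lemma hom_graphN x r : T x r -> T (- x) (- r).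
Proof. by move=> Tx; have := homT.1 _ _ _ _ (hom_graph0 Tx) Tx; rewrite !sub0r. Qed.

Lemma hom_graphD x r y s : T x r -> T y s -> T (x + y) (r + s).
Proof. by move=> Tx /hom_graphN /(homT.1 _ _ _ _ Tx); rewrite !opprK. Qed.

Lemma hom_graphM x r (k : int) : T x r -> T (x *~ k) (r * k%:~R).
Proof.
move=> Tx; have posk n : T (x *~ n%:Z) (r * n%:R).
  elim: n => [|n IH]; first by rewrite mulr0z mulr0; apply: hom_graph0 Tx.
  rewrite -pmulrn mulrS -[n.+1]addn1 natrD mulrDr mulr1 addrC.
  exact: hom_graphD IH Tx.
case: (intP k) => [|n|n]; [exact: (posk 0%N) | exact: (posk n.+1)|].
by rewrite mulrNz intrN mulrN; apply/hom_graphN/(posk n.+1).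
Qed.

Lemma hom_graph_uniq x r s : T x r -> T x s -> r = s.
Proof.
by move=> Tr Ts; apply/subr0_eq/homT.2; have := homT.1 _ _ _ _ Tr Ts; rewrite subrr.
Qed.

(** The rationals are divisible, so the domain can be enlarged by g: the value at
g is forced if a nonzero multiple of g lies in the domain, and arbitrary
otherwise. *)
Lemma hom_graph_extend (g : A) (z : T 0 0) :
  exists T', [/\ hom_graph T', forall x r, T x r -> T' x r & exists r, T' g r].
Proof.
have [q qP] : exists q, forall k s, T (g *~ k) s -> s = q * k%:~R.
  case: (pselect (exists k s, k != 0 /\ T (g *~ k) s)) => [[k [s [k0 Tk]]]|nT].
    exists (s / k%:~R) => k' s' Tk'.
    have := hom_graph_uniq (hom_graphM k' Tk).
    rewrite -mulrzA mulrC mulrzA => /(_ _ (hom_graphM k Tk')) E.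
    by rewrite mulrAC E mulfK // intr_eq0.
  exists 0 => k s Tk; rewrite mul0r; apply: homT.2.
  have [k0|k0] := eqVneq k 0; first by move: Tk; rewrite k0 mulr0z.
  by case: nT; exists k, s.
exists (fun x r => exists y s k, [/\ T y s, x = y + g *~ k & r = s + q * k%:~R]).
split=> [|x r Tx|].
- split=> [x r y s [x' [r' [k [Tx -> ->]]]] [y' [s' [l [Ty -> ->]]]]|r].
    exists (x' - y'), (r' - s'), (k - l); split; first exact: homT.1.
      by rewrite mulrzBr opprD addrACA.
    by rewrite intrB mulrBr opprD addrACA.
  move=> [y [s [k [Ty /esym/eqP]]]]; rewrite addr_eq0 => /eqP yE ->.
  move: Ty; rewrite yE -mulrNz => /qP ->.
  by rewrite intrN mulrN addNr.
- by exists x, r, 0; rewrite mulr0z mulr0 !addr0.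
- by exists q, 0, 0, 1; rewrite !add0r mulr1z mulr1.
Qed.

End HomGraph.

Lemma hom_graph_seq (a : A) (s : seq A) :
  (forall n : int, a *~ n = 0 -> n = 0) ->
  exists T, [/\ hom_graph T, T a 1 & {in s, forall x, exists r, T x r}].
Proof.
move=> a_free; elim: s => [|g s [T [homT Ta Ts]]].
  exists (fun x r => exists n : int, x = a *~ n /\ r = n%:~R); split=> //.
    split=> [_ _ _ _ [m [-> ->]] [n [-> ->]]|r [n [/esym/a_free -> ->]] //].
    by exists (m - n); rewrite mulrzBr intrB.
  by exists 1.
have [T' [homT' TT' T'g]] := hom_graph_extend homT g (hom_graph0 homT Ta).
exists T'; split=> //; first exact: TT'.
move=> x; rewrite inE => /predU1P[-> //|/Ts[r Tr]]; by exists r; apply: TT'.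
Qed.

End ExtendHom.

Section Betti.
Import GRing.Theory Num.Theory Order.TTheory.

Lemma ab_piM (G : groupType) (x y : G) :
  \pi_(abelianization G) (x * y) =
  (\pi_(abelianization G) x + \pi_(abelianization G) y)%R.
Proof. by rewrite -[RHS]/(ab_add _ _) ab_addE. Qed.

(** If the rank is not 0, the abelianization has an element of infinite order;
the homomorphism that sends it to 1 extends to the finitely many generators one
by one. *)
Lemma rat_hom (G : groupType) (M : seq G) :
    (forall x, gen [set` M] x) -> ~ has_betti1 G 0 ->
  exists (phi : G -> rat) (g : G),
    (forall x y, phi (x * y)%g = phi x + phi y)%R /\ phi g = 1%R.
Proof.
move=> genM nb; pose A := abelianization G; pose p := \pi_A : G -> A.
have pM x y : p (x * y) = (p x + p y)%R by apply: ab_piM.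
have p1 : p 1 = 0%R by [].
have pV x : p x^-1 = (- p x)%R.
  by apply/eqP; rewrite -addr_eq0 -pM mulVg p1.
have [a a_free] : exists a : A, forall n : int, (a *~ n = 0)%R -> n = 0%R.
  apply: contrapT => no; apply: nb; split.
    by exists (fun=> 0%R) => ? _ [].
  move=> [//|m] x x_free; case: no; exists (x ord0) => n xn.
  have := x_free (fun i => if i == ord0 then n else 0%R) _ ord0; apply.
  by rewrite big_ord_recl /= xn add0r big1 // => i _; rewrite mulr0z.
have [T [homT Ta TM]] := hom_graph_seq [seq p m | m <- M] a_free.
have T_all g : exists r, T (p g) r.
  move: g (genM g); apply: gen_ind => [m Mm||x y [r Tr] [s Ts]].
  - by apply: TM; apply: map_f.
  - by exists 0%R; rewrite p1; apply: hom_graph0 Ta.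
  - by exists (r - s)%R; rewrite pM pV; apply: homT.1.
pose phi g := projT1 (cid (T_all g)).
have phiE g r : T (p g) r -> phi g = r.
  by rewrite /phi; case: cid => s /= Ts /(hom_graph_uniq homT Ts).
have phiT g : T (p g) (phi g) by rewrite /phi; case: cid.
exists phi, (repr a); split=> [x y|]; apply: phiE.
  by rewrite pM; apply: hom_graphD.
by rewrite /p reprK.
Qed.

Section IntPower.
Variables (G : groupType) (t : G).

Definition zpow (k : int) : G :=
  match k with Posz n => t ^+ n | Negz n => t ^- n.+1 end.

Lemma zpowS k : zpow (k + 1)%R = zpow k * t.
Proof.
case: k => n; first by rewrite addrC -intS /= expgSr.
have -> : (Negz n + 1 = - n%:Z)%R by rewrite NegzE intS opprD addrAC addNr add0r.
case: n => [|n]; first by rewrite oppr0 /= mulVg.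
by rewrite -NegzE /= [t ^+ n.+2]expgS invgM mulgVK.
Qed.

Lemma zpowD k l : zpow (k + l)%R = zpow k * zpow l.
Proof.
have posE m n : zpow (m + n%:Z)%R = zpow m * zpow n.
  elim: n => [|n IH]; first by rewrite addr0 mulg1.
  by rewrite intS addrCA addrC !zpowS IH [zpow n.+1]expgSr mulgA.
case: l => n; first exact: posE.
apply: (mulIg (zpow n.+1)); rewrite -posE NegzE subrK -mulgA.
by rewrite -NegzE /= mulVg mulg1.
Qed.

Lemma zpowN k : zpow (- k)%R = (zpow k)^-1.
Proof. by apply: (mulIg (zpow k)); rewrite -zpowD addNr mulVg. Qed.

Lemma zpow1 : zpow 1 = t. Proof. by []. Qed.

End IntPower.

Definition int_hom (G : groupType) (chi : G -> int) : Prop :=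
  forall x y, (chi (x * y)%g = chi x + chi y)%R.

Section IntHom.
Variables (G : groupType) (chi : G -> int).
Hypothesis chiM : int_hom chi.

Lemma int_hom1 : chi 1 = 0%R.
Proof. by apply: (addrI (chi 1)); rewrite -chiM mulg1 addr0. Qed.

Lemma int_homV x : chi x^-1 = (- chi x)%R.
Proof. by apply: (addrI (chi x)); rewrite -chiM mulgV int_hom1 subrr. Qed.

Lemma int_hom_zpow x k : chi (zpow x k) = (chi x * k)%R.
Proof.
have posE n : chi (x ^+ n) = (chi x * n%:Z)%R.
  elim: n => [|n IH]; first by rewrite int_hom1 mulr0.
  by rewrite expgS chiM IH intS mulrDr mulr1.
by case: k => n; rewrite /zpow ?NegzE ?int_homV posE // mulrN.
Qed.

End IntHom.

(** The values of a homomorphism to the rationals on a finitely generated group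
have a common denominator D, and its multiple by D is onto the multiples of its
least positive value. *)
Lemma int_hom_onto (G : groupType) (M : seq G) :
    (forall x, gen [set` M] x) -> ~ has_betti1 G 0 ->
  exists (chi : G -> int) (t : G), int_hom chi /\ chi t = 1%R.
Proof.
move=> genM nb; have [phi [g [phiM phig]]] := rat_hom genM nb.
have phi1 : phi 1 = 0%R by apply: (addrI (phi 1)); rewrite -phiM mulg1 addr0.
have phiV x : phi x^-1 = (- phi x)%R.
  by apply: (addrI (phi x)); rewrite -phiM mulgV phi1 subrr.
pose D : int := (\prod_(m <- M) denq (phi m))%R.
have D0 : (D%:~R != 0 :> rat)%R.
  by rewrite intr_eq0 prodf_seq_neq0; apply/allP => m _; rewrite /= denq_neq0.
have Dphi x : exists n : int, (D%:~R * phi x = n%:~R)%R.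
  move: x (genM x); apply: gen_ind => [m Mm||x y [n nE] [k kE]].
  - rewrite /D (perm_big _ (perm_to_rem Mm)) big_cons /=.
    exists (numq (phi m) * \prod_(i <- rem m M) denq (phi i))%R.
    by rewrite !intrM numqE [(phi m * _)%R]mulrC mulrAC.
  - by exists 0%R; rewrite phi1 mulr0.
  - by exists (n - k)%R; rewrite phiM phiV mulrDr mulrN nE kE intrB.
pose psi x := projT1 (cid (Dphi x)).
have psiE x : ((psi x)%:~R = D%:~R * phi x)%R by rewrite /psi; case: cid.
have psiM : int_hom psi.
  by move=> x y; apply: (@intr_inj rat); rewrite intrD !psiE phiM mulrDr.
have psig : psi g != 0%R.
  by rewrite -(intr_eq0 rat) psiE phig mulr1.
have ex_n : exists n, `[< exists t, psi t = Posz n.+1 >].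
  move: psig; case E : (psi g) => [[//|n]|n] _.
    by exists n; apply/asboolP; exists g.
  by exists n; apply/asboolP; exists g^-1; rewrite int_homV // E NegzE opprK.
case: (ex_minnP ex_n) => n /asboolP[t tE] nmin.
have dvd x : ((Posz n.+1) %| psi x)%Z.
  have [u uE] : exists u, psi u = ((psi x %/ (Posz n.+1))%Z * (Posz n.+1))%R.
    by exists (zpow t (psi x %/ (Posz n.+1))%Z); rewrite int_hom_zpow // tE mulrC.
  have := erefl (psi (x / u)); rewrite [in LHS]psiM int_homV // uE.
  rewrite {1}(divz_eq (psi x) (Posz n.+1)) addrAC subrr add0r.
  have := modz_ge0 (psi x) (isT : (Posz n.+1) != 0%R).
  have := ltz_pmod (psi x) (isT : (0 < (Posz n.+1))%R).
  move=> ltm ge0m psixu; apply/dvdz_mod0P; move: ltm ge0m psixu.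
  case E : (psi x %% (Posz n.+1))%Z => [[|r]|//] //= ltrn _ psir.
  have : (n <= r)%N by apply: nmin; apply/asboolP; exists (x / u).
  by rewrite leqNgt -ltnS -ltz_nat ltrn.
exists (fun x => (psi x %/ (Posz n.+1))%Z), t; split=> [x y|].
  by rewrite psiM divzDl.
by rewrite tE divzz.
Qed.

End Betti.

(** * Spanning trees of finite coset graphs *)

Section SpanningTree.
Local Open Scope set_scope.
Variables (Q : finGroupType) (A B D : {group Q}) (t : Q).
Hypotheses (properAB : A \proper B) (genD : <<t |: B>> = D).

(** The graph in question has the cosets B x as vertices and the cosets A x as
edges, from B x to B t x. A set that satisfies this contains every point that
can be reached from 1 along the edges in E. *)
Definition connects (E Z : {set Q}) : Prop :=
  [/\ 1 \in Z, {in B & Z, forall b z, b * z \in Z} &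
      {in E, forall v, (v \in Z) = (t * v \in Z)}].

Definition left_invar (H E : {set Q}) : Prop :=
  {in H & E, forall a v, a * v \in E}.

(** Otherwise U would be stable under left translation by t and by B, hence
by D. *)
Lemma boundary_edge (U : {set Q}) :
    U \subset D -> 1 \in U -> left_invar B U -> ~~ (D \subset U) ->
  exists2 u, u \in D & (u \in U) != (t * u \in U).
Proof.
move=> UD U1 BU nDU; apply/exists_inP; apply: contraR nDU => /exists_inPn tU.
pose S := [set g | [forall u in U, g * u \in U]].
have groupS : group_set S.
  apply/group_setP; split=> [|g h].
    by rewrite inE; apply/forall_inP=> u Uu; rewrite mul1g.
  rewrite !inE => /forall_inP gU /forall_inP hU; apply/forall_inP => u Uu.
  by rewrite -mulgA gU ?hU.
have: D \subset Group groupS.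
  rewrite -genD gen_subG; apply/fintype.subsetP => g; rewrite !inE.
  case/predU1P=> [->|Bg]; apply/forall_inP => u Uu; last exact: BU.
  by have := tU u (fintype.subsetP UD u Uu); rewrite negbK Uu => /eqP <-.
move/fintype.subsetP=> DS; apply/fintype.subsetP => d /DS; rewrite inE => /forall_inP/(_ 1 U1).
by rewrite mulg1.
Qed.

Lemma card_proper_double : 2 * #|A| <= #|B|.
Proof.
have /andP[sAB nBA] := properAB.
by rewrite -(Lagrange sAB) mulnC leq_mul2l indexg_gt1 nBA orbT.
Qed.

(** The tree grows by one edge, a coset of A, whenever it reaches a new vertex, a
coset of B, which is at least twice as large. *)
Lemma spanning_tree : exists E : {set Q},
  [/\ left_invar A E, 2 * (#|E| + #|A|) <= #|D| &
      forall Z, connects E Z -> D \subset Z].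
Proof.
have sBD : B \subset D by rewrite -genD sub_gen // finset.subsetUr.
have Dt : t \in D by rewrite -genD mem_gen // setU11.
suff grow n (U E : {set Q}) : #|D :\: U| < n -> U \subset D -> 1 \in U ->
    left_invar B U -> left_invar A E -> 2 * (#|E| + #|A|) <= #|U| ->
    (forall Z, connects E Z -> U \subset Z) -> exists E : {set Q},
    [/\ left_invar A E, 2 * (#|E| + #|A|) <= #|D| &
        forall Z, connects E Z -> D \subset Z].
  apply: (grow _ B finset.set0 (ltnSn _)) => //.
  - by move=> b c Bb Bc; apply: groupM.
  - by move=> a v _; rewrite inE.
  - by rewrite cards0 card_proper_double.
  - by move=> Z [Z1 BZ _]; apply/fintype.subsetP => b Bb; rewrite -[b]mulg1 BZ.
elim: n U E => // n IH U E ltDn UD U1 BU AE leEU UZ.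
have [DU|nDU] := boolP (D \subset U).
  exists E; split=> // [|Z /UZ]; first exact: leq_trans (subset_leq_card UD).
  exact: fintype.subset_trans.
have [u Du uU] := boundary_edge UD U1 BU nDU.
(* The end of the edge that is not yet reached. *)
pose w := if u \in U then t * u else u.
have Dw : w \in D by rewrite /w; case: ifP => _ //; apply: groupM.
have nUw : w \notin U 
  by rewrite /w; case: ifP uU => [_|->] //; case: (t * u \in U).
have disj : U :&: B :* w = finset.set0.
  apply/setP => x; rewrite [RHS]inE; apply/negbTE/negP => /setIP[Ux /rcosetP[b Bb xE]].
  case/negP: nUw; rewrite -[w](mulKg b) -xE; apply: BU => //; exact: groupVr.
have Uw : w \in B :* w by apply/rcosetP; exists 1; rewrite ?mul1g.
apply: (IH (U :|: B :* w) (E :|: A :* u)).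
- rewrite -ltnS; apply: leq_trans (ltDn); rewrite ltnS; apply: proper_card.
  apply/properP; split; first by apply: finset.setDS; apply: finset.subsetUl.
  by exists w; rewrite !inE ?nUw ?Dw // Uw orbT.
- rewrite finset.subUset UD /=; apply/fintype.subsetP => _ /rcosetP[b Bb ->].
  by rewrite groupM // (fintype.subsetP sBD).
- by rewrite inE U1.
- move=> b x Bb /setUP[Ux|/rcosetP[c Bc ->]]; first by rewrite inE BU.
  by rewrite inE mulgA; apply/orP; right; apply/rcosetP; exists (b * c); rewrite ?groupM.
- move=> a x Aa /setUP[Ex|/rcosetP[c Ac ->]]; first by rewrite inE AE.
  by rewrite inE mulgA; apply/orP; right; apply/rcosetP; exists (a * c); rewrite ?groupM.
- rewrite (cardsU U) disj cards0 subn0 card_rcoset.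
  apply: leq_trans (leq_add leEU card_proper_double); rewrite -mulnDr leq_mul2l /=.
  by rewrite leq_add2r -(card_rcoset A u) cardsU leq_subr.
- move=> Z [Z1 BZ EZ]; have sUZ : U \subset Z.
    by apply: UZ; split=> // v Ev; apply: EZ; rewrite inE Ev.
  have Zu : (u \in Z) = (t * u \in Z).
    by apply: EZ; rewrite inE; apply/orP; right; apply/rcosetP; exists 1; rewrite ?mul1g.
  have Zw : w \in Z.
    rewrite /w; move: uU; case: ifP => Uu; first by rewrite -Zu (fintype.subsetP sUZ).
    by case E' : (t * u \in U) => // _; rewrite Zu (fintype.subsetP sUZ).
  rewrite finset.subUset sUZ /=; apply/fintype.subsetP => _ /rcosetP[b Bb ->]; exact: BZ.
Qed.

(** With at least twice as many edges as vertices, a connected graph has two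
edges outside a spanning tree E. *)
Lemma two_free_edges : exists (E : {set Q}) (v w : Q),
  [/\ left_invar A E, forall Z, connects E Z -> D \subset Z,
      v \in D, w \in D & [/\ v \notin E, w \notin E & w \notin A :* v]].
Proof.
have [E [AE leE EZ]] := spanning_tree.
have avoid (X : {set Q}) : #|X| <= #|E| + #|A| -> exists2 x, x \in D & x \notin X.
  move=> leX; apply/subsetPn; apply/negP => /subset_leq_card leD.
  have := leq_trans leE (leq_trans leD leX).
  by rewrite mul2n -addnn -[leqRHS]addn0 leq_add2l leqn0 addn_eq0 !eqn0Ngt cardG_gt0 andbF.
have [|v Dv nEv] := avoid E; first exact: leq_addr.
have [|w Dw] := avoid (E :|: A :* v).
  by rewrite cardsU card_rcoset leq_subr.
by rewrite inE negb_or => /andP[nEw nAvw]; exists E, v, w.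
Qed.

End SpanningTree.

(** * HNN decompositions *)

Section ZConj.
Import GRing.Theory.
Variables (G : groupType) (t : G).

Definition zconj (k : int) (x : G) : G := zpow t k * x * zpow t (- k)%R.

Lemma zconj0 x : zconj 0%R x = x.
Proof. by rewrite /zconj oppr0 mul1g mulg1. Qed.

Lemma zconjD k l x : zconj (k + l)%R x = zconj k (zconj l x).
Proof. by rewrite /zconj opprD [(- k - l)%R]addrC !zpowD !mulgA. Qed.

Lemma zconjM k : {morph zconj k : x y / x * y}.
Proof. by move=> x y; rewrite /zconj zpowN !mulgA mulgVK. Qed.

Lemma zconjK k : cancel (zconj k) (zconj (- k)%R).
Proof. by move=> x; rewrite -zconjD addNr zconj0. Qed.

Lemma zconj1 k : zconj k 1 = 1.
Proof. by rewrite /zconj mulg1 zpowN mulgV. Qed.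

Lemma zconjV k x : zconj k x^-1 = (zconj k x)^-1.
Proof. exact: (homV (multiplicative_of (zconjM k))). Qed.

End ZConj.

Section HNN.
Import GRing.Theory Num.Theory Order.TTheory.
Variables (G : groupType) (chi : G -> int) (t : G) (M : seq G).
Hypotheses (chiM : int_hom chi) (chit : chi t = 1%R) (Mt : t \in M).
Hypothesis genM : forall x, gen [set` M] x.
Hypothesis extM : forall (P : groupType) (f : G -> P), partial_hom M f ->
  exists phi : {multiplicative G -> P}, {in M, phi =1 f}.

(** The factor in the kernel of chi, for the decomposition of G as the product
of this kernel and the powers of t. *)
Definition ker_part (x : G) : G := x * zpow t (- chi x)%R.

Lemma ker_partK x : ker_part x * zpow t (chi x) = x.
Proof. by rewrite /ker_part zpowN mulgVK. Qed.

Lemma ker_partM x y : ker_part (x * y) = ker_part x * zconj t (chi x) (ker_part y).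
Proof.
rewrite /ker_part /zconj chiM opprD [(- _ - _)%R]addrC zpowD !zpowN.
by rewrite !mulgA mulgVK.
Qed.

(** Multiplying by an element of M on the left conjugates kernel parts by powers
of t with exponents up to this bound. It is positive, so that the conjugates
below include the kernel parts themselves. *)
Definition width : nat := (\max_(m <- M) `|chi m|%N).+1.

Lemma width_ge m : m \in M -> (- width%:Z <= chi m <= width%:Z)%R.
Proof.
move=> Mm; rewrite -ler_norml -abszE lez_nat ltnW // ltnS.
exact: leq_bigmax_seq.
Qed.

(* Computation of the bound would clutter the goals. *)
Opaque width.

Definition window (lo hi : int) : subgroup G :=
  gen [set x | exists k m, [/\ (lo <= k <= hi)%R, m \in M & x = zconj t k (ker_part m)]].

Local Notation B := (window (- width%:Z) width%:Z).
Definition edge_gens : seq G :=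
  [seq zconj t (j%:Z - width%:Z) (ker_part m) | m <- M, j <- iota 0 width.*2].
Local Notation A := (gen [set` edge_gens]).

Lemma window_in k m : (- width%:Z <= k <= width%:Z)%R -> m \in M ->
  B (zconj t k (ker_part m)).
Proof. by move=> kN Mm; apply: gen_in; exists k, m. Qed.

Lemma edge_in k m : (- width%:Z <= k < width%:Z)%R -> m \in M ->
  A (zconj t k (ker_part m)).
Proof.
move=> /andP[lek ltk] Mm; apply: gen_in; apply/allpairsP.
have : (0 <= k + width%:Z)%R by rewrite -lerBlDr sub0r.
case E : (k + width%:Z)%R => [j|//] _; exists (m, j); split=> //=.
  rewrite mem_iota add0n -ltz_nat -E -addnn PoszD.
  by rewrite ltrD2r.
by rewrite -E addrK.
Qed.

Lemma edge_gensP x : x \in edge_gens -> exists k m,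
  [/\ (- width%:Z <= k < width%:Z)%R, m \in M & x = zconj t k (ker_part m)].
Proof.
move=> /allpairsP[[m j] [/= Mm]]; rewrite mem_iota add0n => ltj ->.
exists (j%:Z - width%:Z)%R, m; split=> //; rewrite lerBrDl subrr lez_nat leq0n /=.
by rewrite ltrBlDr -PoszD ltz_nat addnn.
Qed.

Lemma edge_sub_vertex : A `<=` B.
Proof.
apply: gen_sub => _ /edge_gensP[k [m [/andP[lek ltk] Mm ->]]].
by apply: window_in; rewrite ?lek ?ltW.
Qed.

Lemma edge_conj a : A a -> B (zconj t 1%R a).
Proof.
move: a; apply: gen_ind => [_ /edge_gensP[k [m [/andP[lek ltk] Mm ->]]]||x y].
- rewrite -zconjD; apply: window_in => //; rewrite addrC lezD1 ltk.
  by rewrite (le_trans lek) // lerDl.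
- by rewrite zconj1; apply: subgroup1.
- by rewrite zconjM zconjV; apply: subgroupF.
Qed.

Lemma gen_vertex_t x : gen (t |` B) x.
Proof.
have genB b : B b -> gen (t |` B) b by move=> Bb; apply: gen_in; right.
have gent k : gen (t |` B) (zpow t k).
  have genX n : gen (t |` B) (t ^+ n).
    elim: n => [|n IH]; first exact: subgroup1.
    by rewrite expgS; apply: subgroupM => //; apply: gen_in; left.
  by case: k => n; [apply: genX | apply: subgroupV].
move: (genM x); apply: gen_sub => m Mm; rewrite -(ker_partK m).
apply: subgroupM; last exact: gent.
by apply: genB; rewrite -[ker_part m](zconj0 t); apply: window_in.
Qed.

(** The map that sends x to beta (ker_part x) p^(chi x) is a partial homomorphism
on M. Indeed, in a product x y the kernel part of y gets conjugated by
t^(chi x), and as this exponent is at most the width, one conjugation by t at a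
time remains within A, where p is known to act as t does. *)
Lemma hnn_extension (P : groupType) (beta : G -> P) (p : P) :
    (forall x y, B x -> B y -> beta (x * y) = beta x * beta y) ->
    (forall a, A a -> p * beta a = beta (zconj t 1%R a) * p) ->
  exists phi : {multiplicative G -> P},
    (forall b, B b -> phi b = beta b) /\ phi t = p.
Proof.
move=> betaM betaA.
have beta1 : beta 1 = 1.
  by apply: (mulgI (beta 1)); rewrite -betaM ?mulg1 //; apply: subgroup1.
have step a : A a -> zconj p 1%R (beta a) = beta (zconj t 1%R a).
  by move=> /betaA pa; rewrite {1}/zconj zpow1 pa zpowN mulgK.
have conj_beta m : m \in M -> forall k, (- width%:Z <= k <= width%:Z)%R ->
    zconj p k (beta (ker_part m)) = beta (zconj t k (ker_part m)).
  move=> Mm; have up (n : nat) : (n <= width)%N ->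
      zconj p n%:Z (beta (ker_part m)) = beta (zconj t n%:Z (ker_part m)).
    elim: n => [_|n IH ltn]; first by rewrite !zconj0.
    rewrite intS !zconjD IH ?(ltnW ltn) // step //; exact: edge_in.
  have down (n : nat) : (n <= width)%N ->
      zconj p (- n%:Z)%R (beta (ker_part m)) = beta (zconj t (- n%:Z)%R (ker_part m)).
    elim: n => [_|n IH ltn]; first by rewrite oppr0 !zconj0.
    apply: (can_inj (zconjK p 1%R)); rewrite step; last first.
      by apply: edge_in => //; rewrite lerN2 lez_nat ltn ltrNl (@lt_le_trans _ _ 0%R).
    by rewrite -!zconjD intS opprD addrA addrN add0r IH // ltnW.
  by case=> n /andP[lo hi]; [apply: up|rewrite NegzE; apply: down; rewrite -lez_nat -lerN2 -NegzE].
pose f x := beta (ker_part x) * zpow p (chi x).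
have Bker m : m \in M -> B (ker_part m).
  by move=> Mm; rewrite -[ker_part m](zconj0 t); apply: window_in.
have [x y Mx My Mxy|phi phiE] := extM (f := f).
  have lex := width_ge Mx.
  rewrite /f ker_partM betaM; [|exact: Bker|exact: window_in].
  rewrite -conj_beta // chiM zpowD /zconj -!mulgA; congr (_ * _).
  by rewrite !mulgA zpowN mulgVK.
have phit : phi t = p by rewrite phiE // /f /ker_part chit zpowN zpow1 mulgV beta1 mul1g.
have phi_zpow l : phi (zpow t l) = zpow p l.
  by case: l => n; rewrite /zpow ?homV homX phit.
have phi_zconj k x : phi (zconj t k x) = zconj p k (phi x).
  by rewrite /zconj !gmulfM !phi_zpow.
exists phi; split=> //; suff Bphi b : B b -> B b /\ phi b = beta b by move=> b /Bphi[].
move: b; apply: gen_ind => [_ [k [m [kN Mm ->]]]||x y [Bx xE] [By yE]].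
- split; first exact: window_in.
  rewrite phi_zconj -conj_beta //; congr zconj.
  have <- : phi m * (phi (zpow t (chi m)))^-1 = phi (ker_part m).
    by rewrite -homF /ker_part zpowN.
  by rewrite phi_zpow phiE // /f mulgK.
- by rewrite hom1 beta1; split=> //; apply: subgroup1.
- split; first exact: subgroupF.
  apply: (mulIg (beta y)); rewrite -betaM ?mulgVK //; last exact: subgroupF.
  by rewrite homF xE -yE mulgVK.
Qed.

End HNN.

(** The property by which the HNN extension of B with stable letter t, which
conjugates A into B, maps to other groups; beta stands for a homomorphism on B,
its values elsewhere being arbitrary. *)
Definition hnn_universal (G : groupType) (t : G) (A B : subgroup G) : Prop :=
  forall (P : groupType) (beta : G -> P) (p : P),
    (forall x y, B x -> B y -> beta (x * y) = beta x * beta y) ->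
    (forall a, A a -> p * beta a = beta (zconj t 1%R a) * p) ->
  exists phi : {multiplicative G -> P},
    (forall b, B b -> phi b = beta b) /\ phi t = p.

(** In a finitely presented group the relators involve conjugates of the
generators of the kernel by finitely many powers of t only, so that a base B
generated by finitely many of them suffices. *)
Lemma bieri_strebel (G : groupType) (chi : G -> int) (t : G) :
    locally_presented G -> int_hom chi -> chi t = 1%R ->
  exists (S : seq G) (B : subgroup G),
    [/\ gen [set` S] `<=` B,
        forall a, gen [set` S] a -> B (zconj t 1%R a),
        forall b, B b -> chi b = 0%R,
        forall x, gen (t |` B) x &
        hnn_universal t (gen [set` S]) B].
Proof.
move=> Gfp chiM chit; have [M [tM genM extM]] := Gfp [:: t].
have Mt : t \in M by apply: tM; rewrite mem_head.
exists (edge_gens chi t M), (window chi t M (- (width chi M)%:Z)%R (width chi M)).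
split.
- exact: edge_sub_vertex.
- exact: edge_conj.
- apply: gen_ind => [_ [k [m [_ _ ->]]]||x y xE yE].
  + rewrite /zconj /ker_part !chiM !int_hom_zpow // chit !GRing.mul1r.
    by rewrite GRing.addrN GRing.addr0 GRing.addrN.
  + exact: int_hom1.
  + by rewrite chiM int_homV // xE yE GRing.oppr0 GRing.addr0.
- exact: gen_vertex_t.
- by move=> P beta p; apply: hnn_extension.
Qed.

(** * Ascending HNN extensions *)

(** In a finite quotient the image of the subgroup has as many elements as the
image of its conjugate by t, which it contains; so they are equal. An element
of the subgroup outside the conjugate would thus not be separated from it. *)
Lemma separable_conj (G : groupType) (S : seq G) (t : G) : separable G ->
    (forall a, gen [set` S] a -> gen [set` S] (zconj t 1%R a)) ->
  forall k a, gen [set` S] a -> gen [set` S] (zconj t k a).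
Proof.
move=> sepG upA; set A := gen _.
have downA a : A a -> A (zconj t (- 1)%R a).
  move=> Aa; apply: contrapT => /sepG[Q [q qA]].
  pose qS : {set Q} := [set x : Q | `[< exists2 b, A b & q b = x >]]%SET.
  have in_qS b : A b -> q b \in qS by move=> Ab; rewrite inE; apply/asboolP; exists b.
  pose c (x : Q) := q t * x * (q t)^-1.
  have cE b : q (zconj t 1%R b) = c (q b) by rewrite /zconj !gmulfM zpowN homV zpow1.
  have c_inj : injective c by move=> x y /mulIg/mulgI.
  have cqS : c @: qS = qS.
    apply/eqP; rewrite eqEcard card_imset // leqnn andbT.
    apply/fintype.subsetP => _ /imsetP[x + ->]; rewrite inE => /asboolP[b Ab <-].
    by rewrite -cE; apply: in_qS; apply: upA.
  have : q a \in c @: qS by rewrite cqS in_qS.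
  move=> /imsetP[x + aE]; rewrite inE => /asboolP[b Ab bE].
  by apply: (qA b) => //; apply: c_inj; rewrite bE -aE -cE -zconjD GRing.addrN zconj0.
have upn (n : nat) a : A a -> A (zconj t n a).
  elim: n => [|n IH] Aa; first by rewrite zconj0.
  by rewrite intS zconjD; apply: upA; apply: IH.
have downn (n : nat) a : A a -> A (zconj t (- n%:Z)%R a).
  elim: n => [|n IH] Aa; first by rewrite GRing.oppr0 zconj0.
  by rewrite intS GRing.opprD zconjD; apply: downA; apply: IH.
by case=> n a Aa; [apply: upn | rewrite NegzE; apply: downn].
Qed.

(** The elements with kernel part in A form a subgroup that contains A and t, so
A is the whole kernel of chi, and the powers of t split chi. *)
Lemma semidirect_of_conj (G : groupType) (chi : G -> int) (t : G) (A : subgroup G) :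
    int_hom chi -> chi t = 1%R -> (forall a, A a -> chi a = 0%R) ->
    (forall k a, A a -> A (zconj t k a)) -> (forall x, gen (t |` A) x) ->
  exists act : int_action (subgroup_type A), isomorphic G (semidirect act).
Proof.
move=> chiM chit chiA conjA genA.
pose a k (x : subgroup_type A) := insubg A (zconj t k (incl x)).
have aE k x : incl (a k x) = zconj t k (incl x).
  by rewrite insubgK //; apply/conjA/inclP.
have a0 x : a 0%R x = x by apply: incl_inj; rewrite aE zconj0.
have aD m n x : a (m + n)%R x = a m (a n x).
  by apply: incl_inj; rewrite !aE zconjD.
have aM m : {morph a m : x y / x * y}.
  by move=> x y; apply: incl_inj; rewrite gmulfM !aE gmulfM zconjM.
pose act := IntAction a0 aD aM; exists act.
have kerA x : A (ker_part chi t x).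
  move: x (genA x); apply: gen_ind => [x [->|Ax]||x y Ax Ay].
  - by rewrite /ker_part chit zpowN mulgV; apply: subgroup1.
  - by rewrite /ker_part chiA // GRing.oppr0 mulg1.
  - by rewrite /ker_part int_hom1 // GRing.oppr0 mulg1; apply: subgroup1.
  - rewrite ker_partM //; apply: subgroupM => //; apply: (conjA).
    have -> : ker_part chi t y^-1 = zconj t (- chi y)%R (ker_part chi t y)^-1.
      by rewrite /ker_part /zconj int_homV // !GRing.opprK invgM mulVKg.
    by apply: conjA; apply: subgroupV.
pose f x : semidirect act := (insubg A (ker_part chi t x), chi x).
have fM : {morph f : x y / x * y}.
  move=> x y; rewrite /f chiM; congr pair; apply: incl_inj.
  by rewrite insubgK // gmulfM aE !insubgK // ker_partM.
exists (multiplicative_of fM).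
exists (fun u : semidirect act => incl u.1 * zpow t u.2) => [x|[x k]].
  by rewrite -[multiplicative_of fM x]/(f x) /f /= insubgK // ker_partK.
rewrite -[LHS]/(f _) /f /=; have chik : chi (incl x * zpow t k) = k.
  by rewrite chiM int_hom_zpow // chit GRing.mul1r chiA ?GRing.add0r //; apply: inclP.
rewrite chik; congr pair; apply: incl_inj.
by rewrite insubgK // /ker_part chik zpowN mulgK.
Qed.

(** * Largeness of proper HNN extensions *)

Section ImageGroup.
Variables (G : groupType) (Q : finGroupType) (q : {multiplicative G -> Q}).

Definition image_set (A : subgroup G) : {set Q} :=
  [set x : Q | `[< exists2 a, A a & q a = x >]]%SET.

Lemma image_setP (A : subgroup G) x :
  reflect (exists2 a, A a & q a = x) (x \in image_set A).
Proof. by rewrite inE; apply: asboolP. Qed.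

Lemma image_group_set (A : subgroup G) : group_set (image_set A).
Proof.
apply/group_setP; split=> [|x y /image_setP[a Aa <-] /image_setP[b Ab <-]].
  by apply/image_setP; exists 1; [apply: subgroup1 | apply: hom1].
by apply/image_setP; exists (a * b); [apply: subgroupM | apply: gmulfM].
Qed.

Definition image_group A : {group Q} := Group (image_group_set A).

Lemma image_group_in (A : subgroup G) a : A a -> q a \in image_group A.
Proof. by move=> Aa; apply/image_setP; exists a. Qed.

Lemma image_groupS (A B : subgroup G) :
  A `<=` B -> (image_group A \subset image_group B)%SET.
Proof.
move=> AB; apply/fintype.subsetP => _ /image_setP[a Aa <-].
by apply: image_group_in; apply: AB.
Qed.

Lemma image_group_gen (t : G) (B : subgroup G) :
  << q t |: image_group B >>%SET = image_group (gen (t |` B)).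
Proof.
apply/eqP; rewrite finset.eqEsubset gen_subG; apply/andP; split.
  apply/fintype.subsetP => x /setU1P[->|/image_setP[b Bb <-]].
    by apply: image_group_in; apply: gen_in; left.
  by apply: image_group_in; apply: gen_in; right.
apply/fintype.subsetP => _ /image_setP[x + <-]; move: x.
apply: gen_ind => [x [->|Bx]||x y xE yE].
- by rewrite mem_gen // setU11.
- by rewrite mem_gen // inE image_group_in // orbT.
- by rewrite hom1 group1.
- by rewrite homF groupM // groupV.
Qed.

End ImageGroup.

Section Large.
Variables (G : groupType) (t : G) (A B : subgroup G).
Hypotheses (AB : A `<=` B) (genB : forall x, gen (t |` B) x).
Hypothesis hnnG : hnn_universal t A B.

Section Labels.
Variables (P : groupType) (e : G -> P).
Hypothesis eA : forall a x, A a -> e (a * x) = e x.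

(** A function that is constant on the cosets A x labels the edges of the graph
that has the cosets B x as vertices and an edge A x from B x to B t x for each
coset of A. Invariance is what makes b |-> (b, 1) and t |-> (t, e) respect the
relations of the HNN extension. *)
Lemma label_cocycle : exists c : G -> G -> P,
  [/\ cocycle c, forall b x, B b -> c b x = 1 & forall x, c t x = e x].
Proof.
pose beta b : wreath P G := (b, fun=> 1).
have [x y _ _|a Aa|phi [phiB phit]] := hnnG (beta := beta) (p := (t, e) : wreath P G).
- by rewrite wr_mulE; congr pair; apply/funext => ?; rewrite mulg1.
- rewrite !wr_mulE /= /zconj zpowN zpow1 mulgVK; congr pair.
  by apply/funext => x; rewrite mulg1 mul1g eA.
exists (fun g => (phi g).2); split=> [|b x Bb|x]; last 2 first.
- by rewrite phiB.
- by rewrite phit.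
by apply: (wreath_cocycle genB) => x [->|Bx]; rewrite ?phit ?phiB.
Qed.

End Labels.

(** The edges of the finite coset graph of q are labelled by 1, except for two
edges outside a spanning tree, which get the two free generators. A loop at 1
that runs inside the tree to one of these two edges, crosses it and runs back
inside the tree has this generator as its label. As loops at 1 are the elements
of the kernel of q, labels map this kernel onto the free group. *)
Lemma large_of_proper (Q : finGroupType) (q : {multiplicative G -> Q}) (b : G) :
  B b -> (forall a, A a -> q a <> q b) -> is_large G.
Proof.
move=> Bb nAb; pose qA := image_group q A; pose qB := image_group q B.
pose qG := image_group q (gen (t |` B)).
have in_qG x : q x \in qG by apply: image_group_in.
have properAB : (qA \proper qB)%SET.
  apply/properP; split; first exact: image_groupS.
  exists (q b); first exact: image_group_in.
  by apply/negP => /image_setP[a Aa /(nAb a Aa)].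
have [E [v [w [AE EZ Dv Dw [nEv nEw nAvw]]]]] :=
  two_free_edges properAB (image_group_gen q t B).
pose F := free_group bool.
pose lab (x : Q) : F := if (x \in qA :* v)%SET then free_gen true
  else if (x \in qA :* w)%SET then free_gen false else 1.
have labA a x : A a -> lab (q (a * x)) = lab (q x).
  move=> /(image_group_in q) qAa.
  by rewrite /lab gmulfM !mem_rcoset -!mulgA !(groupMl _ qAa).
have labE x : x \in E -> lab x = 1.
  move=> Ex; have notin u : u \notin E -> (x \in qA :* u)%SET = false.
    move=> nEu; apply/negbTE; apply: contra nEu => /rcosetP[a qAa xE].
    by rewrite -(mulKg a u) -xE; apply: AE => //; rewrite groupV.
  by rewrite /lab !notin.
have [c [cC cB ct]] := label_cocycle (e := lab \o q) labA.
have cinv g x k : q k = 1 -> c g (x * k) = c g x.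
  apply: (cocycle_invar cC (S := t |` B) (H := fun k => q k = 1)) => //.
  move=> h [->|Bh] y h' qh; last by rewrite !cB.
  by rewrite !ct /= gmulfM qh mulg1.
have reach x : x \in qG -> exists2 h, q h = x & c h 1 = 1.
  pose Z := [set x : Q | `[< exists2 h, q h = x & c h 1 = 1 >]]%SET.
  have ZP y : reflect (exists2 h, q h = y & c h 1 = 1) (y \in Z).
    by rewrite inE; apply: asboolP.
  suff /EZ/fintype.subsetP/(_ x) sDZ : connects qB (q t) E Z by move=> /sDZ/ZP.
  split.
  - by apply/ZP; exists 1; [apply: hom1 | apply: cocycle1].
  - move=> _ z /image_setP[b' Bb' <-] /ZP[h <- ch].
    by apply/ZP; exists (b' * h); rewrite ?gmulfM // cC cB // ch mulg1.
  - move=> x' Ex'; apply/ZP/ZP => -[h qh ch].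
      by exists (t * h); rewrite ?gmulfM ?qh // cC ct ch !mulg1 /= qh labE.
    have qth : q (t^-1 * h) = x' by rewrite gmulfM homV qh mulKg.
    exists (t^-1 * h) => //; have := ch.
    by rewrite -{1}[h](mulVKg t) cC ct mulg1 /= qth labE // mul1g.
have kerP : is_subgroup [set x | q x = 1].
  apply/is_subgroupP; split=> [|x y /= qx qy]; first exact: hom1.
  by rewrite homF qx qy mulgV.
apply: (@is_large_of G (Subgroup kerP) F (fun x => c x 1)).
- by apply: (@finite_index_of _ _ Q q) => x y E' /=; rewrite gmulfM homV E' mulVg.
- by exists bool, (@free_gen _); apply: free_on_free_group.
- exact: free_group_nonabelian.
- apply: (cocycle_hom cC (H := Subgroup kerP)); exact: cinv.
- have loop x : x \in qG -> exists2 k, q k = 1 & c k 1 = lab x.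
    move=> qGx; have [h1 qh1 ch1] := reach x qGx.
    have [h2 qh2 ch2] := reach (q t * x) (groupM (in_qG t) qGx).
    have qk : q (h2^-1 * (t * h1)) = 1.
      by rewrite !gmulfM homV qh1 qh2 mulVg.
    exists (h2^-1 * (t * h1)) => //.
    rewrite cC cocycleV // mulg1 -[h2^-1 * _]mul1g cinv // ch2 invg1 mul1g.
    by rewrite cC ch1 !mulg1 ct /= qh1.
  have inv : lab v = free_gen true by rewrite /lab rcoset_refl.
  have inw : lab w = free_gen false by rewrite /lab (negbTE nAvw) rcoset_refl.
  move=> z; move: z (gen_free_group z); apply: gen_ind => [_ [[] _ <-]||y z [k qk <-] [l ql <-]].
  - by rewrite -inv; apply: loop.
  - by rewrite -inw; apply: loop.
  - by exists 1; [apply: hom1 | apply: cocycle1].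
  - exists (k / l); first by rewrite /= homF qk ql mulgV.
    have qlV : q l^-1 = 1 by rewrite homV ql invg1.
    have c1 g : c g l^-1 = c g 1 by rewrite -[l^-1]mul1g cinv.
    by rewrite /= cC (cocycleV cC) !mulg1 !c1.
Qed.

End Large.

Lemma large_or_semidirect (G : groupType) (chi : G -> int) (t : G) :
    locally_presented G -> separable G -> int_hom chi -> chi t = 1%R ->
  is_large G \/ exists (L : groupType) (act : int_action L),
    finitely_generated L /\ isomorphic G (semidirect act).
Proof.
move=> Gfp sepG chiM chit.
have [S [B [AB tAB chiB genB hnnG]]] := bieri_strebel Gfp chiM chit.
have [BA|nBA] := pselect (B `<=` gen [set` S]).
  right; have conjA := separable_conj sepG (fun a Aa => BA _ (tAB a Aa)).
  have [|x|act isoG] := @semidirect_of_conj G chi t _ chiM chit _ conjA.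
  - by move=> a /AB/chiB.
  - by have := genB x; apply: gen_le => y [->|/BA]; [left|right].
  by exists (subgroup_type (gen [set` S])), act; split=> //; apply: fg_gen.
left; have [b Bb nAb] : exists2 b, B b & ~ gen [set` S] b.
  apply: contrapT => nb; apply: nBA => b Bb.
  by apply: contrapT => nAb; apply: nb; exists b.
have [Q [q qA]] := sepG S b nAb.
exact: (large_of_proper AB genB hnnG Bb qA).
Qed.

Theorem theorem7p3 (G : groupType) :
  finitely_presented G -> is_lerf G ->
  [\/ virtual_betti1_zero G, is_large G | virtually_fg_by_int G].
Proof.
move=> /locally_presented_fp Gfp /separable_lerf sepG.
have [b0|nb0] := pselect (virtual_betti1_zero G); first by constructor 1.
have [H finH nbH] : exists2 H : subgroup G,
    finite_index H & ~ has_betti1 (subgroup_type H) 0.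
  apply: contrapT => nH; apply: nb0 => H finH.
  by apply: contrapT => nbH; apply: nH; exists H.
have Hfp := locally_presented_sub finH Gfp.
have [M [_ genM _]] := Hfp [::].
have [chi [t [chiM chit]]] := int_hom_onto genM nbH.
have [largeH|[L [act [fgL isoH]]]] :=
  large_or_semidirect Hfp (separable_sub sepG) chiM chit.
- by constructor 2; apply: is_large_sub largeH.
- by constructor 3; exists H, L, act.
Qed.
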